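(* Let $T$ be an essentially locally compact m-tower and $E$ a $*$-subalgebra of $C^*_0(T)$. Assume that for every irreducible element $t$ of $T$ one of the following two conditions is fulfilled: (1) $g(t)=0$ for every $g\in E$; or (2) whenever $s\in T$ is irreducible and $s\perp t$, there is $g\in E$ with $g(t)=I_{d(t)}$ and $g(s)=0$. Then the uniform closure of $E$ in $C^*_0(T)$ consists of all $u\in C^*_0(T)$ such that for every $x\in\operatorname{core}(T)$ there exists $v\in E$ with $v(x)=u(x)$.
   Context: Conventions. All topological spaces are Hausdorff; $\mathbb N=\{1,2,\ldots\}$. $M_n$ is the $C^*$-algebra of complex $n\times n$ matrices, $\mathcal U_n$ its unitary group, $I_n$ its unit. For $U\in\mathcal U_n$, $X\in M_n$: $U.X=UXU^{-1}$. For $X\in M_n$, $Y\in M_k$, $X\oplus Y\in M_{n+k}$ is the block-diagonal matrix. Towers. A tower is a topological space $T$ with a continuous function $d\colon T\to\mathbb N$, an operation $\oplus\colon T\times T\to T$ and functions $\mathcal U_n\times T_n\ni(U,x)\mapsto U.x\in T$ (where $T_n=d^{-1}(\{n\})$), such that: (T1) $\oplus$ is associative and continuous, and for each $n$ the map $T_n\times T\ni(x,y)\mapsto x\oplus y\in T$ is a closed embedding; (T2) $d(x\oplus y)=d(x)+d(y)$ and $d(U.x)=d(x)$; (T3) each $\mathcal U_n\times T_n\to T_n$ is a continuous group action; (T4) $U.x=x$ if $U\in\mathcal U_{d(x)}$ is a scalar multiple of the unit matrix; (T5) $(U\oplus V).(x\oplus y)=(U.x)\oplus(V.y)$ for $x\in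 T_n$, $y\in T_k$, $U\in\mathcal U_n$, $V\in\mathcal U_k$; (T6) $U_{d(x),d(y)}.(x\oplus y)=y\oplus x$, where $U_{p,q}\in\mathcal U_{p+q}$ is given by $(w_1,\ldots,w_q,z_1,\ldots,z_p)\cdot U_{p,q}=(z_1,\ldots,z_p,w_1,\ldots,w_q)$ (row vectors). Let $T$ be a tower. An element $x$ is reducible if $V.x=a\oplus b$ for some $a,b\in T$, $V\in\mathcal U_{d(x)}$; otherwise it is irreducible. $\operatorname{stab}(x)=\{U\in\mathcal U_{d(x)}: U.x=x\}$. $x\equiv y$ means $U.x=y$ for some $U\in\mathcal U_{d(x)}$; $x\preccurlyeq y$ means that $x\equiv y$ or there are $a,b\in T$ with $x\equiv a$, $y\equiv a\oplus b$; $x\perp y$ ($x,y$ disjoint) means there is no $a\in T$ with $a\preccurlyeq x$ and $a\preccurlyeq y$. $\operatorname{core}(T)$ is the set of irreducible elements and $\overline{\operatorname{core}}(T)$ is its closure in $T$. A topological space $X$ has property $(\sigma)$ if there are sets $K_1\subset K_2\subset\cdots$ with union $X$, each compact Hausdorff in the subspace topology, such that $B\subset X$ is closed iff $B\cap K_n$ is closed for each $n$. An m-tower is a tower $T$ that has property $(\sigma)$ and satisfies for all $x,y,z\in T$: (mT1) if $z\perp x$ and $z\perp y$, then $z\perp x\oplus y$; (mT2) if $z\oplus x\equiv z\oplus y$, then $x\equiv y$; (mT3) if $x\perp y$, then $\operatorname{stab}(x\oplus y)=\{U\oplus V: U\in\operatorname{stab}(x),\ V\in\operatorname{stab}(y)\}$;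 (mT4) if $x$ is irreducible and $p=d(x)$, then for each $n>0$ the stabilizer of the $n$-fold sum $x\oplus\cdots\oplus x$ is $\{I_p\otimes U: U\in\mathcal U_n\}$, where $I_p\otimes[u_{jk}]$ is the block matrix $[u_{jk}I_p]$. $C^*(T)$ is the unital $C^*$-algebra (pointwise operations, supremum norm) of all functions $f$ on $T$ with $f(x)\in M_{d(x)}$, $f|_{T_n}\colon T_n\to M_n$ continuous for all $n$, $f(U.x)=U.f(x)$ for $U\in\mathcal U_{d(x)}$, $f(x\oplus y)=f(x)\oplus f(y)$, and $\|f\|=\sup_{x\in T}\|f(x)\|<\infty$. An m-tower $T$ is essentially locally compact if the space $\overline{\operatorname{core}}(T)$ is locally compact. Then $C^*_0(T)$ is the $*$-subalgebra of all $f\in C^*(T)$ such that for each $\varepsilon>0$ there is a compact $K\subset\overline{\operatorname{core}}(T)$ with $\|f(t)\|\le\varepsilon$ for all $t\in\overline{\operatorname{core}}(T)\setminus K$. *)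

(* Defs.v *)
From HB Require Import structures.
From mathcomp Require Import all_boot all_order all_algebra.
From mathcomp Require Import complex mxtens.
From mathcomp Require Import all_classical all_reals all_analysis.

Set Implicit Arguments.
Unset Strict Implicit.
Unset Printing Implicit Defensive.

Import Order.TTheory GRing.Theory Num.Theory.
Import numFieldNormedType.Exports.

Local Open Scope classical_set_scope.
Local Open Scope ring_scope.

Reserved Notation "x \oplus y" (at level 50, left associativity).

(* [R[i]] itself carries no topology; seen as a [numClosedFieldType] it does,
   and so do matrices over it. *)
Definition Cplx (R : realType) : numClosedFieldType := complex R.

Section Matrices.
Variable R : realType.
Local Notation C := (Cplx R).

Definition vnorm n (v : 'cV[C]_n) : R :=
  Num.sqrt (\sum_(i < n) complex.Re `|v i ord0| ^+ 2).

(* The C*-norm of M_n (the canonical norm of ['M_n] in the library is the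
   entrywise maximum). *)
Definition opnorm n (A : 'M[C]_n) : R :=
  sup [set vnorm (A *m v) | v in [set v | vnorm v <= 1]].

Definition mxdsum p q (X : 'M[C]_p) (Y : 'M[C]_q) : 'M[C]_(p + q) :=
  block_mx X 0 0 Y.

Definition mxact n (U X : 'M[C]_n) : 'M[C]_n := U *m X *m invmx U.

(* The unitary U_{p,q}; [mul_row_swapmx] is its definition on row vectors. *)
Definition swapmx p q : 'M[C]_(p + q) :=
  castmx (addnC q p, erefl) (block_mx (0 : 'M[C]_(q, p)) 1%:M 1%:M 0).

Lemma mul_row_swapmx p q (w : 'rV[C]_q) (z : 'rV[C]_p) :
  castmx (erefl, addnC q p) (row_mx w z) *m swapmx p q = row_mx z w.
Proof.
rewrite /swapmx mulmx_cast castmx_comp !castmx_id.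
by rewrite mul_row_block !mulmx0 !mulmx1 add0r addr0.
Qed.

End Matrices.

(* A homeomorphism onto a closed subspace. *)
Definition closed_embedding (X Y : topologicalType) (f : X -> Y) : Prop :=
  [/\ injective f,
      forall A : set X, open A <-> exists2 B : set Y, open B & f @^-1` B = A
    & closed (range f)].

(* [act n U x] stands for U.x; it is meaningful only for [U] unitary of size
   [n = deg x] and is left unspecified elsewhere. Keeping [n] separate from
   [deg x] avoids casts in the axioms about [x \oplus y]. *)
Record tower (R : realType) := Tower {
  tower_space :> topologicalType;
  deg : tower_space -> nat;
  tsum : tower_space -> tower_space -> tower_space;
  act : forall n : nat, 'M[Cplx R]_n -> tower_space -> tower_space;
  tower_hausdorff : hausdorff_space tower_space;
  deg_gt0 : forall x, (0 < deg x)%N;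
  deg_continuous : continuous deg;
  tsumA : associative tsum;
  tsum_continuous : continuous (fun p : tower_space * tower_space =>
                                  tsum p.1 p.2);
  tsum_closed_embedding : forall n : nat,
    closed_embedding
      (fun p : set_type [set x | deg x = n] * tower_space =>
         tsum (set_val p.1) p.2);
  deg_tsum : forall x y, deg (tsum x y) = (deg x + deg y)%N;
  deg_act : forall x (U : 'M[Cplx R]_(deg x)), U \is unitarymx ->
    deg (act U x) = deg x;
  act_continuous : forall n : nat,
    {within [set p : 'M[Cplx R]_n * tower_space |
              p.1 \is unitarymx /\ deg p.2 = n],
      continuous (fun p => act p.1 p.2)};
  act1 : forall x, act (1%:M : 'M[Cplx R]_(deg x)) x = x;
  actM : forall x (U V : 'M[Cplx R]_(deg x)), U \is unitarymx -> V \is unitarymx ->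
    act (U *m V) x = act U (act V x);
  act_scalar : forall x (U : 'M[Cplx R]_(deg x)), U \is unitarymx ->
    is_scalar_mx U -> act U x = x;
  act_tsum : forall x y (U : 'M[Cplx R]_(deg x)) (V : 'M[Cplx R]_(deg y)),
    U \is unitarymx -> V \is unitarymx ->
    act (mxdsum U V) (tsum x y) = tsum (act U x) (act V y);
  act_swap : forall x y,
    act (swapmx R (deg x) (deg y)) (tsum x y) = tsum y x
}.

Arguments deg {R t} _.
Arguments tsum {R t} _ _.
Arguments act {R t n} _ _.

Notation "x \oplus y" := (tsum x y).

Section TowerTheory.
Variables (R : realType) (T : tower R).
Local Notation C := (Cplx R).
Implicit Types x y a b : T.

Definition reducible x : Prop :=
  exists a b, exists2 V : 'M[C]_(deg x), V \is unitarymx & act V x = a \oplus b.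

Definition irreducible x : Prop := ~ reducible x.

(* Empty unless [n = deg x]; the index [n] avoids casts. *)
Definition stab (n : nat) x : set 'M[C]_n :=
  [set U | [/\ deg x = n, U \is unitarymx & act U x = x]].

Definition equivt x y : Prop :=
  exists2 U : 'M[C]_(deg x), U \is unitarymx & act U x = y.

Definition subt x y : Prop :=
  equivt x y \/ exists a b, equivt x a /\ equivt y (a \oplus b).

Definition disjt x y : Prop := ~ exists a, subt a x /\ subt a y.

Definition core : set T := [set x | irreducible x].

Definition clcore : set T := closure core.

(* Only meaningful for [n > 0]: [nsum 0 x] is [x]. *)
Definition nsum (n : nat) x : T := iterop n tsum x x.

End TowerTheory.

Arguments stab {R T} n%_N x.
Arguments core {R} T.
Arguments clcore {R} T.

Definition property_sigma (X : topologicalType) : Prop :=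
  exists K : nat -> set X,
    [/\ forall n, K n `<=` K n.+1,
        \bigcup_n K n = setT,
        forall n, compact (K n) /\ hausdorff_space (set_type (K n))
      & forall B : set X, closed B <-> forall n, closed (B `&` K n)].

(* In [mtower_stab_nsum], [U *t 1%:M] is the block matrix [u_jk I_p]; with the
   opposite convention for Kronecker products it is written I_p (x) U. *)
Record is_mtower (R : realType) (T : tower R) : Prop := IsMTower {
  mtower_sigma : property_sigma T;
  mtower_disjt : forall x y z : T,
    disjt z x -> disjt z y -> disjt z (x \oplus y);
  mtower_cancel : forall x y z : T,
    equivt (z \oplus x) (z \oplus y) -> equivt x y;
  mtower_stab_disjt : forall x y : T, disjt x y ->
    stab (deg x + deg y) (x \oplus y) =
    [set W | exists U V, [/\ stab (deg x) x U, stab (deg y) y V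
                           & W = mxdsum U V]];
  mtower_stab_nsum : forall (x : T) (n : nat), irreducible x -> (0 < n)%N ->
    stab (n * deg x) (nsum n x) =
    [set U *t (1%:M : 'M[Cplx R]_(deg x)) |
       U in [set U : 'M[Cplx R]_n | U \is unitarymx]]
}.

Definition essentially_locally_compact (R : realType) (T : tower R) : Prop :=
  locally_compact [set: set_type (clcore T)].

Section Functions.
Variables (R : realType) (T : tower R).
Local Notation C := (Cplx R).

Definition tfun : Type := forall x : T, 'M[C]_(deg x).

Implicit Types f g u v : tfun.

(* [f x] read in M_n when [deg x = n] (and [0] otherwise). *)
Definition fval (n : nat) f (x : T) : 'M[C]_n := conform_mx 0 (f x).

Definition tzero : tfun := fun x => 0.
Definition tadd f g : tfun := fun x => f x + g x.
Definition tsub f g : tfun := fun x => f x - g x.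
Definition tscale (c : C) f : tfun := fun x => c *: f x.
Definition tmul f g : tfun := fun x => f x *m g x.
Definition tadj f : tfun := fun x => ((f x) ^t*)%sesqui.

Definition norms f : set R := range (fun x : T => opnorm (f x)).

Definition supnorm f : R := sup (norms f).

Record in_Cstar f : Prop := InCstar {
  Cstar_continuous : forall n : nat,
    {within [set x : T | deg x = n], continuous (fval n f)};
  Cstar_act : forall (x : T) (U : 'M[C]_(deg x)), U \is unitarymx ->
    fval (deg x) f (act U x) = mxact U (f x);
  Cstar_tsum : forall x y : T,
    fval (deg x + deg y)%N f (x \oplus y) = mxdsum (f x) (f y);
  Cstar_bounded : has_ubound (norms f)
}.

Definition Cstar : set tfun := [set f | in_Cstar f].

Definition Cstar0 : set tfun :=
  [set f | Cstar f /\
    forall e : R, 0 < e ->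
      exists K : set T, [/\ K `<=` clcore T, compact K
        & forall t, (clcore T `\` K) t -> opnorm (f t) <= e]].

Record star_subalgebra (A E : set tfun) : Prop := StarSubalgebra {
  subalg_sub : E `<=` A;
  subalg0 : E tzero;
  subalgD : forall f g, E f -> E g -> E (tadd f g);
  subalgZ : forall (c : C) f, E f -> E (tscale c f);
  subalgM : forall f g, E f -> E g -> E (tmul f g);
  subalg_adj : forall f, E f -> E (tadj f)
}.

Definition uniform_closure (A E : set tfun) : set tfun :=
  [set u | A u /\
    forall e : R, 0 < e -> exists2 v, E v & supnorm (tsub u v) < e].

End Functions.

Arguments Cstar0 {R} T.

(* Main.v *)
Require Import Defs.
From mathcomp Require Import all_boot all_order all_algebra.
From mathcomp Require Import complex ring lra.
From mathcomp Require Import all_classical all_reals all_analysis.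

(* Write X for the closure of the core, and E(x) = {v(x) : v in E}. Since E(x) is
   a linear subspace of a finite-dimensional space it is closed, which gives one
   inclusion. Conversely, let u(x) be in E(x) for all irreducible x. Every element
   of T is equivalent to a direct sum of irreducible ones, so it is enough to
   approximate u on X. This is done on X_n = {x in X : d(x) <= n} by induction on
   n. Let w = u - v where v in E approximates u on X_(n-1). The points of X_n at
   which w is not small form a compact set of irreducible elements of dimension
   n. Let t be one of them, and y in X_n not equivalent to t. No component of y
   is equivalent to t, so some g in E satisfies g(t) = 1 and g(y) = 0, and
   compactness arguments lead to elements of E that are close to 1 on a compact
   set of such t and close to 0 on a disjoint closed set. A layer cake sum of
   those approximates on X_n any scalar function that is expressed by norms, and
   such scalars suffice to glue local approximants of w.
   All functional calculus is done with explicit polynomials in g^* g. *)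

Set Implicit Arguments.
Unset Strict Implicit.
Unset Printing Implicit Defensive.

Import Order.TTheory GRing.Theory Num.Theory.
Import numFieldNormedType.Exports.

Local Open Scope classical_set_scope.
Local Open Scope ring_scope.

(** * The operator norm *)

Section OperatorNorm.
Variable R : realType.
Local Notation C := (Cplx R).
Local Notation r2c := (real_complex R : R -> C).

Lemma Re_norm_r2c (z : C) : r2c (complex.Re `|z|) = `|z|.
Proof. by rewrite [X in r2c (complex.Re X)](@normc_def R z) [RHS](@normc_def R z). Qed.

Lemma vnorm_ge0 n (v : 'cV[C]_n) : 0 <= vnorm v.
Proof. exact: sqrtr_ge0. Qed.

Lemma vnorm_sqr n (v : 'cV[C]_n) :
  vnorm v ^+ 2 = \sum_(i < n) complex.Re `|v i ord0| ^+ 2.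
Proof. by rewrite sqr_sqrtr// sumr_ge0// => i _; rewrite sqr_ge0. Qed.

Lemma vnorm_sqrC n (v : 'cV[C]_n) :
  r2c (vnorm v ^+ 2) = (v ^t* *m v)%sesqui 0 0.
Proof.
rewrite vnorm_sqr (rmorph_sum (real_complex R)) mxE; apply: eq_bigr => i _.
by rewrite !mxE rmorphXn /= Re_norm_r2c normCK mulrC.
Qed.

Lemma vnorm_eqP n m (u : 'cV[C]_n) (v : 'cV[C]_m) :
  (u ^t* *m u)%sesqui 0 0 = (v ^t* *m v)%sesqui 0 0 -> vnorm u = vnorm v.
Proof.
rewrite -!vnorm_sqrC => /complexI e; apply/eqP.
by rewrite -(eqrXn2 (n := 2))// ?vnorm_ge0// e.
Qed.

(** Through this identity with the Hermitian form [dotmx] on row vectors, the triangle inequality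
    and Cauchy-Schwarz become available for [vnorm]. *)
Lemma vnormE n (v : 'cV[C]_n) : r2c (vnorm v) = sqrtC (dotmx v^T v^T).
Proof.
rewrite dotmxE trmxK.
have -> : (v^T *m map_mx Num.conj v) 0 0 = r2c (vnorm v ^+ 2).
  by rewrite vnorm_sqrC !mxE; apply: eq_bigr => i _; rewrite !mxE mulrC.
rewrite rmorphXn sqrCK//= -[0]/(r2c 0) lecR vnorm_ge0//.
Qed.

Lemma vnormD n (u v : 'cV[C]_n) : vnorm (u + v) <= vnorm u + vnorm v.
Proof.
rewrite -(@lecR R) rmorphD /= !vnormE linearD /=.
exact: (triangle_lerif (@dotmx _ n)).
Qed.

Lemma vdot_le n (u v : 'cV[C]_n) :
  `|(u ^t* *m v)%sesqui 0 0| <= r2c (vnorm u * vnorm v).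
Proof.
rewrite rmorphM /= !vnormE mulrC.
have -> : (u ^t* *m v)%sesqui 0 0 = dotmx v^T u^T.
  by rewrite dotmxE trmxK !mxE; apply: eq_bigr => i _; rewrite !mxE mulrC.
exact: (CauchySchwarz_sqrt (@dotmx _ n)).
Qed.

Lemma vnorm0 n : vnorm (0 : 'cV[C]_n) = 0.
Proof.
by apply/eqP; rewrite -sqrf_eq0 vnorm_sqr big1// => i _; rewrite mxE normr0/= expr0n.
Qed.

Lemma vnorm_eq0 n (v : 'cV[C]_n) : (vnorm v == 0) = (v == 0).
Proof.
apply/eqP/eqP => [v0|->]; last exact: vnorm0.
have := vnormE v; rewrite v0 => /esym/eqP.
by rewrite sqrtC_eq0 dnorm_eq0 => /eqP e; rewrite -[v]trmxK e trmx0.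
Qed.

Lemma vnormZ n (c : C) (v : 'cV[C]_n) :
  vnorm (c *: v) = complex.Re `|c| * vnorm v.
Proof.
apply: (@complexI R); rewrite rmorphM /= Re_norm_r2c !vnormE linearZ /= dnormZ.
by rewrite sqrtCM ?nnegrE ?exprn_ge0 ?dnorm_ge0// sqrCK.
Qed.

Lemma vnormZr n (c : R) (v : 'cV[C]_n) : vnorm (r2c c *: v) = `|c| * vnorm v.
Proof. by rewrite vnormZ normc_def /= expr0n addr0 sqrtr_sqr. Qed.

Lemma vnorm_unitary n (P : 'M[C]_n) (v : 'cV[C]_n) :
  P \is unitarymx -> vnorm (P *m v) = vnorm v.
Proof.
move=> uP; apply: vnorm_eqP; rewrite trmx_mul map_mxM mulmxA -[X in X *m _]mulmxA.
move: uP; rewrite -trmxC_unitary => /unitarymxP; rewrite trmxCK => ->.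
by rewrite mulmx1.
Qed.

Lemma vnorm_colmx p q (u : 'cV[C]_p) (v : 'cV[C]_q) :
  vnorm (col_mx u v) ^+ 2 = vnorm u ^+ 2 + vnorm v ^+ 2.
Proof.
by rewrite !vnorm_sqr big_split_ord /=; congr (_ + _); apply: eq_bigr => i _;
  rewrite ?col_mxEu ?col_mxEd.
Qed.

(** Crude, but enough to show that the set defining [opnorm] is bounded and to compare [opnorm] with
    the entries. *)
Lemma vnorm_mul_bound n (A : 'M[C]_n) (v : 'cV[C]_n) :
  vnorm (A *m v) <= (\sum_j vnorm (col j A)) * vnorm v.
Proof.
have -> : A *m v = \sum_j v j 0 *: col j A.
  apply/colP => i; rewrite mxE summxE; apply: eq_bigr => j _.
  by rewrite !mxE mulrC.
rewrite mulr_suml; elim/big_ind2: _ => [|x a y b hx hy|j _].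
- by rewrite vnorm0.
- by rewrite (le_trans (vnormD _ _))// lerD.
rewrite vnormZ mulrC ler_wpM2l ?vnorm_ge0//.
rewrite -(@ler_pXn2r _ 2)// ?nnegrE ?vnorm_ge0//; last first.
  by rewrite -(@lecR R) /= Re_norm_r2c normr_ge0.
rewrite vnorm_sqr (bigD1 j)//= lerDl sumr_ge0// => i _; exact: sqr_ge0.
Qed.

Definition opbound n (A : 'M[C]_n) (c : R) : Prop :=
  forall v, vnorm (A *m v) <= c * vnorm v.

Lemma opnorm_has_sup n (A : 'M[C]_n) :
  has_sup [set vnorm (A *m v) | v in [set v | vnorm v <= 1]].
Proof.
split; first by exists 0, 0 => //=; rewrite ?mulmx0 vnorm0//.
exists (\sum_j vnorm (col j A)) => _ [v /= v1 <-].
apply: le_trans (vnorm_mul_bound A v) _.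
by rewrite ler_piMr// sumr_ge0// => j _; exact: vnorm_ge0.
Qed.

Lemma opnorm_ge0 n (A : 'M[C]_n) : 0 <= opnorm A.
Proof.
rewrite /opnorm; apply: ub_le_sup; first by case: (opnorm_has_sup A).
by exists 0 => //=; rewrite ?mulmx0 vnorm0.
Qed.

Lemma opnormP n (A : 'M[C]_n) (v : 'cV[C]_n) :
  vnorm (A *m v) <= opnorm A * vnorm v.
Proof.
have [/eqP v0|v0] := boolP (v == 0); first by rewrite v0 mulmx0 vnorm0 mulr0.
have nv : 0 < vnorm v by rewrite lt_def vnorm_eq0 v0 vnorm_ge0.
rewrite -ler_pdivrMr//; apply: ub_le_sup; first by case: (opnorm_has_sup A).
exists (r2c (vnorm v)^-1 *: v) => /=.
  by rewrite vnormZr ger0_norm ?invr_ge0 ?vnorm_ge0// mulVf ?gt_eqF.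
by rewrite -scalemxAr vnormZr ger0_norm ?invr_ge0 ?vnorm_ge0// mulrC.
Qed.

Lemma opnorm_le n (A : 'M[C]_n) c : 0 <= c -> opbound A c -> opnorm A <= c.
Proof.
move=> c0 Ac; apply: ge_sup; first by case: (opnorm_has_sup A).
by move=> _ [v /= v1 <-]; apply: le_trans (Ac v) _; rewrite ler_piMr.
Qed.

Lemma opnormD n (A B : 'M[C]_n) : opnorm (A + B) <= opnorm A + opnorm B.
Proof.
apply: opnorm_le => [|v]; first by rewrite addr_ge0 ?opnorm_ge0.
by rewrite mulmxDl mulrDl (le_trans (vnormD _ _))// lerD ?opnormP.
Qed.

Lemma opnormM n (A B : 'M[C]_n) : opnorm (A *m B) <= opnorm A * opnorm B.
Proof.
apply: opnorm_le => [|v]; first by rewrite mulr_ge0 ?opnorm_ge0.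
rewrite -mulmxA (le_trans (opnormP _ _))// -mulrA ler_wpM2l ?opnorm_ge0//.
exact: opnormP.
Qed.

Lemma opnormM_le n (A B : 'M[C]_n) a b :
  opnorm A <= a -> opnorm B <= b -> opnorm (A *m B) <= a * b.
Proof.
by move=> Aa Bb; apply: le_trans (opnormM _ _) _; rewrite ler_pM ?opnorm_ge0.
Qed.

Lemma opnorm0 n : opnorm (0 : 'M[C]_n) = 0.
Proof.
apply/eqP; rewrite eq_le opnorm_ge0 andbT opnorm_le// => v.
by rewrite mul0mx vnorm0 mul0r.
Qed.

Lemma opnorm_eq0 n (A : 'M[C]_n) : opnorm A <= 0 -> A = 0.
Proof.
move=> A0; apply/matrixP => i j; rewrite mxE.
have : A *m delta_mx j (0 : 'I_1) = 0.
  apply/eqP; rewrite -vnorm_eq0 eq_le vnorm_ge0 andbT.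
  apply: le_trans (opnormP _ _) _.
  by rewrite mulr_le0_ge0 ?vnorm_ge0.
by rewrite -colE => /colP/(_ i); rewrite !mxE.
Qed.

Lemma opnormZr n (c : R) (A : 'M[C]_n) : opnorm (r2c c *: A) <= `|c| * opnorm A.
Proof.
apply: opnorm_le => [|v]; first by rewrite mulr_ge0 ?opnorm_ge0.
by rewrite -scalemxAl vnormZr -mulrA ler_wpM2l ?opnormP.
Qed.

Lemma opnormN n (A : 'M[C]_n) : opnorm (- A) = opnorm A.
Proof.
have h (B : 'M[C]_n) : opnorm (- B) <= opnorm B.
  have := opnormZr (-1) B; rewrite normrN1 mul1r.
  by rewrite (rmorphN (real_complex R)) (rmorph1 (real_complex R)) scaleN1r.
have := h (- A); rewrite opprK => h'.
by apply/eqP; rewrite eq_le; apply/andP; split; [exact: h|exact: h'].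
Qed.

Lemma opnormB n (A B : 'M[C]_n) : opnorm (A - B) <= opnorm A + opnorm B.
Proof. by rewrite -(opnormN B); exact: opnormD. Qed.

Lemma opnorm_distC n (A B : 'M[C]_n) : opnorm (A - B) = opnorm (B - A).
Proof. by rewrite -[LHS]opnormN opprB. Qed.

Lemma opnorm1_le n : opnorm (1%:M : 'M[C]_n) <= 1.
Proof. by apply: opnorm_le => // v; rewrite mul1mx mul1r. Qed.

Lemma opnorm_scalar_le n (c : R) : opnorm ((r2c c)%:M : 'M[C]_n) <= `|c|.
Proof.
rewrite -scalemx1 (le_trans (opnormZr _ _))// ler_piMr// opnorm1_le//.
Qed.

Lemma opnorm_unitaryl n (P A : 'M[C]_n) :
  P \is unitarymx -> opnorm (P *m A) <= opnorm A.
Proof.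
move=> uP; apply: opnorm_le => [|v]; first exact: opnorm_ge0.
by rewrite -mulmxA vnorm_unitary// opnormP.
Qed.

Lemma opnorm_unitaryr n (P A : 'M[C]_n) :
  P \is unitarymx -> opnorm (A *m P) <= opnorm A.
Proof.
move=> uP; apply: opnorm_le => [|v]; first exact: opnorm_ge0.
by rewrite -mulmxA -[in leRHS](vnorm_unitary v uP) opnormP.
Qed.

Lemma mxactK n (U A : 'M[C]_n) :
  U \is unitarymx -> invmx U *m mxact U A *m U = A.
Proof.
move=> uU; have Uu := unitarymx_unit uU.
by rewrite /mxact -!mulmxA mulVmx// mulmx1 mulKmx.
Qed.

Lemma opnorm_mxact n (U A : 'M[C]_n) :
  U \is unitarymx -> opnorm (mxact U A) = opnorm A.
Proof.
move=> uU; have uV : invmx U \is unitarymx by rewrite (invmx_unitary uU) trmxC_unitary.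
apply/eqP; rewrite eq_le; apply/andP; split.
  exact: le_trans (opnorm_unitaryr _ uV) (opnorm_unitaryl _ uU).
have := le_trans (opnorm_unitaryr _ uU) (opnorm_unitaryl (mxact U A) uV).
by rewrite mxactK.
Qed.

(** If w is the image of v under the adjoint, then |w|^2 = <v, A w> is at most |v| |A| |w|, and |w|
    cancels. *)
Lemma opnorm_adj n (A : 'M[C]_n) : opnorm (A ^t*)%sesqui <= opnorm A.
Proof.
apply: opnorm_le => [|v]; first exact: opnorm_ge0.
set w := (_ *m v).
have [->|w0] := eqVneq (vnorm w) 0; first by rewrite mulr_ge0 ?opnorm_ge0 ?vnorm_ge0.
have nw : 0 < vnorm w by rewrite lt_def w0 vnorm_ge0.
rewrite -(ler_pM2r nw) -expr2.
have : r2c (vnorm w ^+ 2) <= r2c (vnorm v * vnorm (A *m w)).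
  rewrite vnorm_sqrC {1}/w trmx_mul map_mxM trmxCK -mulmxA.
  apply: le_trans (vdot_le _ _); apply: real_ler_norm.
  have -> : (v ^t* *m (A *m w))%sesqui = (w ^t* *m w)%sesqui.
    by rewrite /w trmx_mul map_mxM trmxCK -!mulmxA.
  by rewrite -vnorm_sqrC; apply/complex_realP; exists (vnorm w ^+ 2).
rewrite lecR => /le_trans; apply.
rewrite mulrAC [leRHS]mulrC ler_wpM2l ?vnorm_ge0//.
exact: opnormP.
Qed.

End OperatorNorm.

(** * Entries, block sums and real functional calculus of matrices *)

Section MatrixFunctions.
Variable R : realType.
Local Notation C := (Cplx R).
Local Notation r2c := (real_complex R : R -> C).

Lemma vnorm_delta n (i : 'I_n) : vnorm (delta_mx i 0 : 'cV[C]_n) = 1.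
Proof.
apply: (@complexI R); rewrite vnormE dotmxE trmxK trmx_delta -rowE !mxE !eqxx.
by rewrite conjC1 sqrtC1 rmorph1.
Qed.

Lemma opnorm_entries n (A : 'M[C]_n) :
  opnorm A <= \sum_j \sum_i complex.Re `|A i j|.
Proof.
have Re0 (z : C) : 0 <= complex.Re `|z|.
  by rewrite -(@lecR R) Re_norm_r2c normr_ge0.
apply: opnorm_le => [|v]; first by rewrite !sumr_ge0// => j _; rewrite sumr_ge0.
apply: le_trans (vnorm_mul_bound A v) _.
apply: ler_wpM2r; first exact: vnorm_ge0.
apply: ler_sum => j _.
have -> : col j A = \sum_i A i j *: delta_mx i 0.
  apply/colP => i; rewrite !mxE summxE (bigD1 i)//= !mxE !eqxx mulr1.
  rewrite big1 ?addr0// => k ki.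
  by rewrite !mxE eq_sym (negbTE ki) mulr0.
elim/big_ind2: _ => [|x a y b hx hy|i _].
- by rewrite vnorm0.
- by rewrite (le_trans (vnormD _ _))// lerD.
by rewrite vnormZ vnorm_delta mulr1.
Qed.

(** By Pythagoras the norm of a block sum is the larger of the two norms. Stated with upper bounds,
    this iterates over lists of summands without maxima. *)
Lemma opnorm_mxdsum p q (X : 'M[C]_p) (Y : 'M[C]_q) c :
  opnorm (mxdsum X Y) <= c <-> opnorm X <= c /\ opnorm Y <= c.
Proof.
have mulE (u : 'cV[C]_p) (v : 'cV[C]_q) :
    mxdsum X Y *m col_mx u v = col_mx (X *m u) (Y *m v).
  by rewrite /mxdsum mul_block_col !mul0mx addr0 add0r.
have col0 (m k : nat) (u : 'cV[C]_m) : vnorm (col_mx u (0 : 'cV[C]_k)) = vnorm u.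
  apply/eqP; rewrite -(eqrXn2 (n := 2))// ?vnorm_ge0//.
  by rewrite vnorm_colmx vnorm0 expr0n addr0.
have col0' (m k : nat) (u : 'cV[C]_m) : vnorm (col_mx (0 : 'cV[C]_k) u) = vnorm u.
  apply/eqP; rewrite -(eqrXn2 (n := 2))// ?vnorm_ge0//.
  by rewrite vnorm_colmx vnorm0 expr0n add0r.
split=> [h|[hX hY]].
  have c0 : 0 <= c by rewrite (le_trans _ h)// opnorm_ge0.
  split; apply: opnorm_le => // v.
    have := opnormP (mxdsum X Y) (col_mx v 0).
    rewrite mulE mulmx0 !col0 => /le_trans; apply.
    by rewrite ler_wpM2r ?vnorm_ge0.
  have := opnormP (mxdsum X Y) (col_mx 0 v).
  rewrite mulE mulmx0 !col0' => /le_trans; apply.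
  by rewrite ler_wpM2r ?vnorm_ge0.
have c0 : 0 <= c by rewrite (le_trans _ hX)// opnorm_ge0.
apply: opnorm_le => // v; rewrite -[v]vsubmxK mulE.
rewrite -(@ler_pXn2r _ 2)// ?nnegrE ?mulr_ge0 ?vnorm_ge0//.
rewrite exprMn !vnorm_colmx mulrDr -!exprMn lerD//.
  rewrite ler_pXn2r// ?nnegrE ?mulr_ge0 ?vnorm_ge0//.
  by apply: le_trans (opnormP _ _) _; rewrite ler_wpM2r ?vnorm_ge0.
rewrite ler_pXn2r// ?nnegrE ?mulr_ge0 ?vnorm_ge0//.
by apply: le_trans (opnormP _ _) _; rewrite ler_wpM2r ?vnorm_ge0.
Qed.

Lemma mxexprS n (A : 'M[C]_n) k : A ^+ k.+1 = A *m A ^+ k.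
Proof. exact: exprS. Qed.

(** For unitary [P], the Hermitian matrix with eigenvalues [f i] in the orthonormal basis of columns
    of the adjoint of [P]. With [P] fixed, polynomials act pointwise on [f]. *)
Definition cdiag n (P : 'M[C]_n) (f : 'I_n -> R) : 'M[C]_n :=
  (P ^t*)%sesqui *m diag_mx (\row_i r2c (f i)) *m P.

Section ConjugatedDiagonal.
Variables (n : nat) (P : 'M[C]_n).
Hypothesis uP : P \is unitarymx.

Let PPt : P *m (P ^t*)%sesqui = 1%:M.
Proof. exact/unitarymxP. Qed.

Let PtP : (P ^t*)%sesqui *m P = 1%:M.
Proof. by move: uP; rewrite -trmxC_unitary => /unitarymxP; rewrite trmxCK. Qed.

Lemma cdiagM f g : cdiag P f *m cdiag P g = cdiag P (fun i => f i * g i).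
Proof.
rewrite /cdiag -!mulmxA (mulmxA P) PPt mul1mx; congr (_ *m _).
rewrite !mulmxA mulmx_diag; congr (diag_mx _ *m _).
by apply/rowP => i; rewrite !mxE rmorphM.
Qed.

Lemma cdiagD f g : cdiag P f + cdiag P g = cdiag P (fun i => f i + g i).
Proof.
rewrite /cdiag; have -> : \row_i r2c (f i + g i) = \row_i r2c (f i) + \row_i r2c (g i).
  by apply/rowP => i; rewrite !mxE rmorphD.
by rewrite raddfD /= mulmxDr mulmxDl.
Qed.

Lemma cdiagZ c f : r2c c *: cdiag P f = cdiag P (fun i => c * f i).
Proof.
rewrite /cdiag; have -> : \row_i r2c (c * f i) = r2c c *: \row_i r2c (f i).
  by apply/rowP => i; rewrite !mxE rmorphM.
by rewrite linearZ /= -scalemxAr -scalemxAl.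
Qed.

Lemma cdiag1 : 1%:M = cdiag P (fun=> 1).
Proof.
rewrite /cdiag; have -> : \row_(i < n) r2c 1 = const_mx 1.
  by apply/rowP => i; rewrite !mxE rmorph1.
by rewrite diag_const_mx mulmx1 PtP.
Qed.

Lemma cdiagB f g : cdiag P f - cdiag P g = cdiag P (fun i => f i - g i).
Proof.
rewrite -[- cdiag P g]scaleN1r -(rmorph1 (real_complex R)).
rewrite -(rmorphN (real_complex R)) cdiagZ cdiagD; congr (cdiag P _).
by apply/funext => i; rewrite mulN1r.
Qed.

Lemma cdiagX f k : cdiag P f ^+ k = cdiag P (fun i => f i ^+ k).
Proof.
elim: k => [|k IH].
  by rewrite expr0 [LHS]cdiag1; congr (cdiag P _); apply/funext.
by rewrite mxexprS IH cdiagM; congr (cdiag P _); apply/funext => i; rewrite exprS.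
Qed.

Lemma cdiag_adj f : (cdiag P f ^t*)%sesqui = cdiag P f.
Proof.
rewrite /cdiag !trmx_mul !map_mxM trmxCK mulmxA tr_diag_mx map_diag_mx.
have -> // : map_mx Num.conj (\row_i r2c (f i)) = \row_i r2c (f i).
by apply/rowP => i; rewrite !mxE; apply/CrealP/complex_realP; exists (f i).
Qed.

(** In the coordinates [P *m v] the form is a sum of squared moduli with weights [f i]. Its value is
    passed as a real [t], the form itself being complex. *)
Lemma cdiag_form (f : 'I_n -> R) (v : 'cV[C]_n) t c :
  (forall i, f i <= c) -> r2c t = (v ^t* *m cdiag P f *m v)%sesqui 0 0 ->
  t <= c * vnorm v ^+ 2.
Proof.
move=> fc te; rewrite -(vnorm_unitary v uP).
suff -> : t = \sum_i f i * complex.Re `|(P *m v) i 0| ^+ 2.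
  rewrite vnorm_sqr mulr_sumr; apply: ler_sum => i _.
  by rewrite ler_wpM2r ?sqr_ge0.
apply: (@complexI R); rewrite [LHS]te (rmorph_sum (real_complex R)).
have -> : (v ^t* *m cdiag P f *m v)%sesqui =
    ((P *m v) ^t* *m diag_mx (\row_i r2c (f i)) *m (P *m v))%sesqui.
  by rewrite /cdiag trmx_mul map_mxM !mulmxA.
rewrite -mulmxA mxE; apply: eq_bigr => i _.
rewrite mul_diag_mx !mxE rmorphM rmorphXn /= Re_norm_r2c normCK.
by rewrite mulrCA [X in _ * X]mulrC.
Qed.

Lemma opnorm_cdiag f c : (forall i, `|f i| <= c) -> 0 <= c ->
  opnorm (cdiag P f) <= c.
Proof.
move=> fc c0; apply: opnorm_le => // v.
rewrite -(@ler_pXn2r _ 2)// ?nnegrE ?mulr_ge0 ?vnorm_ge0// exprMn.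
apply: (@cdiag_form (fun i => f i * f i)) => [i|].
  by rewrite -expr2 -real_normK ?num_real// ler_pXn2r ?nnegrE.
rewrite vnorm_sqrC trmx_mul map_mxM cdiag_adj -cdiagM.
by move: (cdiag P f) (v ^t*)%sesqui => a b; rewrite !mulmxA.
Qed.

(** Write D for [cdiag P f] and G for the Gram matrix of A. The squared norm of A D v is <v, D G D
    v>, and D G D is diagonal in the same basis, with entries [d i * f i ^+ 2]. *)
Lemma opnorm_mul_cdiag (A : 'M[C]_n) d f c :
  (A ^t* *m A)%sesqui = cdiag P d -> (forall i, d i * f i ^+ 2 <= c) -> 0 <= c ->
  opnorm (A *m cdiag P f) ^+ 2 <= c.
Proof.
move=> Ad fc c0; rewrite -[leRHS]sqr_sqrtr// ler_pXn2r ?nnegrE ?opnorm_ge0 ?sqrtr_ge0//.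
apply: opnorm_le => [|v]; first exact: sqrtr_ge0.
rewrite -(@ler_pXn2r _ 2)// ?nnegrE ?mulr_ge0 ?sqrtr_ge0 ?vnorm_ge0//.
rewrite exprMn (sqr_sqrtr c0).
apply: (@cdiag_form (fun i => f i * (d i * f i))) => [i|].
  by rewrite mulrCA -expr2.
rewrite vnorm_sqrC 2!trmx_mul 2!map_mxM cdiag_adj -!cdiagM -Ad.
move: (cdiag P f) (v ^t*)%sesqui (A ^t*)%sesqui => a b e.
by rewrite !mulmxA.
Qed.

End ConjugatedDiagonal.

(** The eigenvalue at a unit eigenvector is the squared norm of its image under A, which gives both
    bounds at once. *)
Lemma gram_spectral n (A : 'M[C]_n) :
  exists P d, [/\ P \is unitarymx, (A ^t* *m A)%sesqui = cdiag P d
                & forall i, 0 <= d i <= opnorm A ^+ 2].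
Proof.
set G := (A ^t* *m A)%sesqui.
have GG : (G ^t*)%sesqui = G by rewrite /G trmx_mul map_mxM trmxCK.
have /orthomx_spectralP : G \is normalmx by apply/normalmxP; rewrite GG.
set P := spectralmx G; set s := spectral_diag G => Gs.
have uP : P \is unitarymx by exact: spectral_unitarymx.
have PPt : P *m (P ^t*)%sesqui = 1%:M by exact/unitarymxP.
pose Q := A *m (P ^t*)%sesqui.
have QQ : (Q ^t* *m Q)%sesqui = diag_mx s.
  have -> : (Q ^t* *m Q)%sesqui = P *m G *m (P ^t*)%sesqui.
    rewrite /Q trmx_mul map_mxM trmxCK /G.
    by move: (P ^t*)%sesqui (A ^t*)%sesqui => a b; rewrite !mulmxA.
  rewrite Gs invmx_unitary//; move: (diag_mx s) PPt => D.
  by move: (P ^t*)%sesqui => a Pa; rewrite !mulmxA Pa mul1mx -mulmxA Pa mulmx1.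
pose w i : 'cV[C]_n := col i Q.
have sw i : s 0 i = r2c (vnorm (w i) ^+ 2).
  rewrite vnorm_sqrC; move/matrixP/(_ i i): QQ.
  rewrite !mxE eqxx mulr1n => <-; apply: eq_bigr => k _.
  by rewrite !mxE.
have srow : \row_i r2c (vnorm (w i) ^+ 2) = s by apply/rowP => i; rewrite mxE sw.
exists P, (fun i => vnorm (w i) ^+ 2); split=> [||i]; first exact: uP.
  rewrite /cdiag srow -(invmx_unitary uP); exact: Gs.
rewrite sqr_ge0 /= ler_pXn2r// ?nnegrE ?vnorm_ge0 ?opnorm_ge0// /w colE -mulmxA.
apply: le_trans (opnormP _ _) _; rewrite ler_piMr ?opnorm_ge0//.
by rewrite vnorm_unitary ?trmxC_unitary// vnorm_delta.
Qed.

End MatrixFunctions.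

(** * Polynomials in the Gram matrix *)

Section GramPolynomials.
Variable R : realType.
Local Notation C := (Cplx R).
Local Notation r2c := (real_complex R : R -> C).

(** With m = b + 1 the base is 1 - (y - 1)/m, nonnegative on this range, so the power is at most
    exp(1 - y); and y is at most exp(y - 1). *)
Lemma peak_le1 (b : nat) (y : R) : 0 <= y <= 1 + b.+1%:R ->
  0 <= y * (1 + b.+1%:R^-1 - b.+1%:R^-1 * y) ^+ b.+1 <= 1.
Proof.
move=> /andP[y0 yb]; set z := (X in _ * X ^+ _).
have b0 : (0 : R) < b.+1%:R by rewrite ltr0n.
have zE : z = 1 + - ((y - 1) / b.+1%:R) by rewrite /z; field; rewrite gt_eqF.
have z0 : 0 <= z.
  by rewrite zE subr_ge0 ler_pdivrMr// mul1r lerBlDl.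
apply/andP; split; first by rewrite mulr_ge0 ?exprn_ge0.
have h1 : y <= expR (y - 1) by rewrite (le_trans _ (expR_ge1Dx _))//; lra.
have h2 : z ^+ b.+1 <= expR (- (y - 1)).
  have -> : - (y - 1) = b.+1%:R * - ((y - 1) / b.+1%:R) by field; rewrite gt_eqF.
  by rewrite expRM_natl lerXn2r ?nnegrE ?expR_ge0// zE expR_ge1Dx.
rewrite (le_trans (ler_pM y0 (exprn_ge0 _ z0) h1 h2))//.
by rewrite -expRD subrr expR0.
Qed.

Lemma step_bounds (t : R) : 0 <= t <= 1 -> 0 <= t * (t * (3 + -2 * t)) <= 1.
Proof.
move=> /andP[t0 t1]; have h : 0 <= 3 + -2 * t by lra.
rewrite !mulr_ge0//= -subr_ge0.
have -> : 1 - t * (t * (3 + -2 * t)) = (1 - t) ^+ 2 * (1 + 2 * t) by ring.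
by rewrite mulr_ge0 ?sqr_ge0//; lra.
Qed.

(** The last bound combines Bernoulli, 1 + k y <= (1 + y)^k, with (1 + y)(1 - y) <= 1. *)
Lemma cut_bounds (k : nat) (y : R) : 0 <= y <= 1 ->
  [/\ 0 <= (1 - y) ^+ k <= 1, 1 - (1 - y) ^+ k <= k%:R * y
    & k%:R * y * (1 - y) ^+ k <= 1].
Proof.
move=> /andP[y0 y1]; have z0 : 0 <= 1 - y by rewrite subr_ge0.
have z1 : 1 - y <= 1 by rewrite gerBl.
have k1 : 0 <= (1 - y) ^+ k <= 1 by rewrite exprn_ge0// exprn_ile1.
have bern : 1 + k%:R * y <= (1 + y) ^+ k.
  elim: (k) => [|m IH]; first by rewrite mul0r addr0 expr0.
  rewrite exprS -nat1r.
  have hp : (1 + y) * (1 + m%:R * y) <= (1 + y) * (1 + y) ^+ m.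
    by rewrite ler_wpM2l// addr_ge0.
  apply: le_trans hp.
  have : 0 <= m%:R * y * y by rewrite !mulr_ge0.
  nra.
split=> //.
  elim: (k) => [|m IH]; first by rewrite expr0 subrr mul0r.
  have hm : 0 <= (1 - y) ^+ m <= 1 by rewrite exprn_ge0// exprn_ile1.
  rewrite exprS -nat1r; move: IH hm; set t := (1 - y) ^+ m; nra.
have : (1 + k%:R * y) * (1 - y) ^+ k <= 1.
  apply: (@le_trans _ _ ((1 + y) ^+ k * (1 - y) ^+ k)).
    by rewrite ler_wpM2r//; case/andP: k1.
  rewrite -exprMn exprn_ile1//; nra.
by move: k1; set t := (1 - y) ^+ k; nra.
Qed.

Variable n : nat.
Implicit Types A G : 'M[C]_n.

Definition gram A : 'M[C]_n := (A ^t* *m A)%sesqui.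

Definition affmx (a b : R) G : 'M[C]_n := (r2c a)%:M + r2c b *: G.

Lemma affmx_cdiag P a b d : P \is unitarymx ->
  affmx a b (cdiag P d) = cdiag P (fun i => a + b * d i).
Proof.
move=> uP; rewrite /affmx -scalemx1 (cdiag1 uP) !cdiagZ cdiagD.
by congr (cdiag P _); apply/funext => i; rewrite mulr1.
Qed.

(** The leading Gram factor removes the constant term, so that values stay in a subalgebra without
    unit. *)
Definition peakmx b A : 'M[C]_n :=
  gram A *m affmx (1 + b.+1%:R^-1) (- b.+1%:R^-1) (gram A) ^+ b.+1.

Lemma opnorm_peakmx b A : opnorm A ^+ 2 <= 1 + b.+1%:R -> opnorm (peakmx b A) <= 1.
Proof.
move=> Ab; have [P [d [uP Ad dP]]] := gram_spectral A.
rewrite /peakmx /gram Ad affmx_cdiag// cdiagX// cdiagM// opnorm_cdiag// => i.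
have /andP[d0 d1] := dP i.
have /peak_le1/andP[p0 p1] : 0 <= d i <= 1 + b.+1%:R.
  by rewrite d0 (le_trans d1).
by rewrite mulNr ger0_norm.
Qed.

(* [3 s ^ 2 - 2 s ^ 3] maps [0, 1] to itself and has 0 and 1 as superattracting
   fixed points. *)
Definition stepmx A : 'M[C]_n := gram A *m (gram A *m affmx 3 (-2) (gram A)).

Lemma opnorm_gram A c : opnorm A <= c -> opnorm (gram A) <= c * c.
Proof.
by move=> Ac; exact: opnormM_le (le_trans (opnorm_adj _) Ac) Ac.
Qed.

Lemma stepmx_cdiag A : opnorm A <= 1 -> exists P d, [/\ P \is unitarymx,
  gram A = cdiag P d, stepmx A = cdiag P (fun i => d i * (d i * (3 + -2 * d i)))
  & forall i, 0 <= d i <= 1].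
Proof.
move=> A1; have [P [d [uP Ad dP]]] := gram_spectral A.
have GE : gram A = cdiag P d by exact: Ad.
exists P, d; split=> [|||i]; [exact: uP|exact: GE| |].
  rewrite /stepmx GE (affmx_cdiag _ _ _ uP) 2!(cdiagM uP); reflexivity.
have /andP[-> d1] := dP i; rewrite (le_trans d1)//.
by rewrite exprn_ile1// opnorm_ge0.
Qed.

Lemma opnorm_stepmx A : opnorm A <= 1 -> opnorm (stepmx A) <= 1.
Proof.
move=> /stepmx_cdiag[P [d [uP _ -> dP]]]; apply: opnorm_cdiag => // i.
by have /andP[h0 h1] := step_bounds (dP i); rewrite ger0_norm; lra.
Qed.

Lemma opnorm_1Bstepmx A : opnorm A <= 1 -> opnorm (1%:M - stepmx A) <= 1.
Proof.
move=> /stepmx_cdiag[P [d [uP _ -> dP]]].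
rewrite (cdiag1 uP) cdiagB; apply: opnorm_cdiag => // i.
by have /andP[h0 h1] := step_bounds (dP i); rewrite ger0_norm; lra.
Qed.

Lemma opnorm_affmx a b A : opnorm (affmx a b A) <= `|a| + `|b| * opnorm A.
Proof.
rewrite /affmx; apply: le_trans (opnormD _ _) _.
by apply: lerD; [exact: opnorm_scalar_le|exact: opnormZr].
Qed.

(** One Gram factor gives t^2 and the rest is at most 5. The larger constant 12 is the one of
    [stepmx_near1], so that both estimates iterate alike. *)
Lemma stepmx_near0 A t : opnorm A <= 1 -> opnorm A <= t ->
  opnorm (stepmx A) <= 12 * t ^+ 2.
Proof.
move=> A1 At; have t0 : 0 <= t by rewrite (le_trans _ At)// opnorm_ge0.
have G1 := opnorm_gram A1; have Gt := opnorm_gram At.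
have : opnorm (stepmx A) <= (t * t) * (1 * 1 * (3 + 2 * (1 * 1))).
  apply: (opnormM_le Gt (opnormM_le G1 _)).
  apply: le_trans (opnorm_affmx _ _ _) _.
  rewrite normrN !normr_nat lerD2l ler_wpM2l//; exact: G1.
move/le_trans; apply; clear -t0; nra.
Qed.

Lemma adj_1B A : ((1%:M - A) ^t*)%sesqui = (1%:M - A ^t*)%sesqui.
Proof.
apply/matrixP => i j; rewrite !mxE rmorphB /= eq_sym.
by congr (_ - _); case: (i == j); rewrite ?rmorph1 ?rmorph0.
Qed.

(** Uses 1 - 3 s^2 + 2 s^3 = (1 - s)^2 (1 + 2 s) at s = [gram A]. As A need not be Hermitian, 1 - s
    is split into the adjoint of 1 - A and a multiple of 1 - A, whence the bound 2 t. *)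
Lemma stepmx_near1 A t : opnorm A <= 1 -> opnorm (1%:M - A) <= t ->
  opnorm (1%:M - stepmx A) <= 12 * t ^+ 2.
Proof.
move=> A1 At; have t0 : 0 <= t by rewrite (le_trans _ At)// opnorm_ge0.
have [P [d [uP Gd -> dP]]] := stepmx_cdiag A1.
have -> : 1%:M - cdiag P (fun i => d i * (d i * (3 + -2 * d i))) =
    (1%:M - gram A) *m ((1%:M - gram A) *m affmx 1 2 (gram A)).
  have e1 : 1%:M - gram A = cdiag P (fun i => 1 - d i).
    rewrite Gd (cdiag1 uP) cdiagB; reflexivity.
  have e2 : affmx 1 2 (gram A) = cdiag P (fun i => 1 + 2 * d i).
    by rewrite Gd; exact: affmx_cdiag.
  rewrite e1 e2 2!(cdiagM uP) (cdiag1 uP) cdiagB; congr (cdiag P _).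
  by apply/funext => i; ring.
have G2 : opnorm (1%:M - gram A) <= t + 1 * t.
  have -> : 1%:M - gram A = (1%:M - A ^t*)%sesqui + (A ^t* *m (1%:M - A))%sesqui.
    by rewrite /gram mulmxBr mulmx1 addrA subrK.
  apply: le_trans (opnormD _ _) (lerD _ _).
    rewrite -adj_1B; exact: le_trans (opnorm_adj _) At.
  exact: opnormM_le (le_trans (opnorm_adj _) A1) At.
have : opnorm ((1%:M - gram A) *m ((1%:M - gram A) *m affmx 1 2 (gram A))) <=
    (t + 1 * t) * ((t + 1 * t) * (1 + 2 * (1 * 1))).
  apply: (opnormM_le G2 (opnormM_le G2 _)).
  apply: le_trans (opnorm_affmx _ _ _) _.
  rewrite normr1 normr_nat lerD2l ler_wpM2l//; exact: opnorm_gram.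
move/le_trans; apply; clear -t0; nra.
Qed.

(** Again a polynomial without constant term. It serves as an approximate unit for [A], with a
    resolution set by N / k. *)
Definition cutmx (N : R) k A : 'M[C]_n := 1%:M - affmx 1 (- N^-1) (gram A) ^+ k.

(** For an eigenvalue d of the Gram matrix, y = d / N lies in [0, 1] and [cut_bounds] applies. By
    the third bound the cut is small where A is small; by the fourth it is nearly a right unit for
    A. *)
Lemma cutmxP (N : R) k A : 0 < N -> opnorm A ^+ 2 <= N ->
  [/\ opnorm (cutmx N k A) <= 1, opnorm (1%:M - cutmx N k A) <= 1,
      opnorm (cutmx N k A) <= k%:R / N * opnorm A ^+ 2
    & (0 < k)%N -> opnorm (A *m (1%:M - cutmx N k A)) ^+ 2 <= N / k%:R].
Proof.
move=> N0 AN; have [P [d [uP Ad dP]]] := gram_spectral A.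
have yP i : 0 <= d i / N <= 1.
  have /andP[d0 d1] := dP i.
  by rewrite divr_ge0 ?(ltW N0)//= ler_pdivrMr// mul1r (le_trans d1).
have GE : gram A = cdiag P d by exact: Ad.
have e : cutmx N k A = cdiag P (fun i => 1 - (1 - d i / N) ^+ k).
  rewrite /cutmx GE (affmx_cdiag _ _ _ uP) (cdiagX uP) (cdiag1 uP) cdiagB.
  by congr (cdiag P _); apply/funext => i; rewrite mulNr [N^-1 * _]mulrC.
have e' : 1%:M - cutmx N k A = cdiag P (fun i => (1 - d i / N) ^+ k).
  rewrite e (cdiag1 uP) cdiagB.
  by congr (cdiag P _); apply/funext => i; rewrite subKr.
split; rewrite ?e' ?e.
- apply: opnorm_cdiag => // i; have [/andP[a b] _ _] := cut_bounds k (yP i).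
  by rewrite ger0_norm; lra.
- apply: opnorm_cdiag => // i; have [/andP[a b] _ _] := cut_bounds k (yP i).
  by rewrite ger0_norm; lra.
- apply: (opnorm_cdiag uP) => [i|].
    have [/andP[a b] c _] := cut_bounds k (yP i).
    rewrite ger0_norm; last by lra.
    apply: (le_trans c); rewrite mulrA mulrAC.
    apply: ler_wpM2l; first by rewrite divr_ge0// ltW.
    by case/andP: (dP i).
  by rewrite mulr_ge0 ?sqr_ge0// divr_ge0// ltW.
move=> k0; have kR : (0 : R) < k%:R by rewrite ltr0n.
apply: (opnorm_mul_cdiag uP Ad) => [i|]; last by rewrite divr_ge0// ltW.
have [/andP[a b] _ c] := cut_bounds k (yP i).
have /andP[y0 y1] := yP i.
rewrite ler_pdivlMr//.
have dE : d i = N * (d i / N) by field; rewrite gt_eqF.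
rewrite [X in X * _ ^+ 2]dE.
set y := d i / N in a b c y0 y1 *; set r := (1 - y) ^+ k in a b c *.
have -> : N * y * r ^+ 2 * k%:R = N * (k%:R * y * r) * r by ring.
rewrite -[leRHS]mulr1 ler_pM//; last by rewrite ler_piMr// ltW.
exact: mulr_ge0 (ltW N0) (mulr_ge0 (mulr_ge0 (ler0n _ _) y0) a).
Qed.

End GramPolynomials.

(** * Functions on a tower *)

Section TowerFunctions.
Variables (R : realType) (T : tower R).
Local Notation C := (Cplx R).
Local Notation r2c := (real_complex R : R -> C).
Implicit Types (x y a b s t : T) (f g u v : tfun T).

Lemma opnorm_near n (A : 'M[C]_n) e : 0 < e ->
  \forall B \near A, opnorm (A - B) < e.
Proof.
(* There are n * n entries, each off by at most d; the successor keeps the sum strictly below e and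
   covers n = 0. *)
move=> e0; pose d := e / (n * n).+1%:R.
have d0 : 0 < d by rewrite divr_gt0// ltr0n.
apply/nbhs_ballP; exists (r2c d) => /=; first by rewrite -[0]/(r2c 0) ltcR.
move=> B [_ AB]; apply: le_lt_trans (opnorm_entries _) _.
apply: (@le_lt_trans _ _ (\sum_(j < n) \sum_(i < n) d)).
  apply: ler_sum => j _; apply: ler_sum => i _.
  have := AB i j; rewrite -ball_normE /ball_ /= => ABij.
  by rewrite -(@lecR R) Re_norm_r2c !mxE; apply: ltW.
rewrite !sumr_const !card_ord -mulrnA -mulr_natr /d mulrAC ltr_pdivrMr ?ltr0n//.
by rewrite ltr_pM2l// ltr_nat.
Qed.

Lemma opnorm_fval n f x : deg x = n -> opnorm (fval n f x) = opnorm (f x).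
Proof. by move=> <-; rewrite /fval conform_mx_id. Qed.

Lemma open_deg (P : set nat) : open [set x : T | P (deg x)].
Proof.
apply: (@open_comp _ _ (@deg R T) P) => [x _|]; first exact: deg_continuous.
exact: discrete_open.
Qed.

Lemma fvalB n f g : fval n (tsub f g) = (fun x => fval n f x - fval n g x).
Proof.
apply/funext => x; have [<-|xn] := eqVneq (deg x) n.
  by rewrite /fval !conform_mx_id.
by rewrite /fval !nonconform_mx ?xn ?subrr.
Qed.

Lemma Cstar_near f x : Cstar f -> forall e, 0 < e ->
  \forall y \near x, opnorm (fval (deg x) f x - fval (deg x) f y) < e.
Proof.
move=> [fc _ _ _] e e0; have := fc (deg x).
rewrite continuous_open_subspace; last exact: (open_deg [set deg x]).
move=> /(_ x (mem_set erefl)) h.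
exact: (h _ (opnorm_near (fval (deg x) f x) e0)).
Qed.

Lemma opnorm_continuous f : Cstar f -> continuous (fun x => opnorm (f x)).
Proof.
move=> fC x; apply/cvgrPdist_lt => e e0.
have ox : \forall y \near x, deg y = deg x.
  by apply: open_nbhs_nbhs; split => //; exact: (open_deg [set deg x]).
near=> y.
have yx : deg y = deg x by near: y.
rewrite -(opnorm_fval f (erefl (deg x))) -(opnorm_fval f yx).
apply: (@le_lt_trans _ _ (opnorm (fval (deg x) f x - fval (deg x) f y))).
  rewrite ler_norml; set A := fval _ f x; set B := fval _ f y.
  have h1 := opnormD (A - B) B; rewrite subrK in h1.
  have h2 := opnormD (B - A) A; rewrite subrK opnorm_distC in h2.
  by rewrite lerBlDr h1 lerNl opprB lerBlDr h2.
by near: y; exact: Cstar_near.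
Unshelve. all: by end_near. Qed.

Lemma opnorm_equivt f x y : Cstar f -> equivt x y -> opnorm (f x) = opnorm (f y).
Proof.
move=> [_ fact _ _] [U uU <-].
rewrite -(opnorm_fval f (deg_act uU)) (fact _ _ uU) (opnorm_mxact _ uU).
reflexivity.
Qed.

Lemma deg_equivt x y : equivt x y -> deg x = deg y.
Proof. by move=> [U uU <-]; rewrite deg_act. Qed.

Lemma unitarymx_1 n : (1%:M : 'M[C]_n) \is unitarymx.
Proof. by apply/unitarymxP; rewrite trmx1 map_mx1 mulmx1. Qed.

Lemma equivt_refl x : equivt x x.
Proof. by exists 1%:M; [exact: unitarymx_1|exact: act1]. Qed.

(** Allows [U] of a size only provably equal to [deg x], as happens for [act U x] after
    [deg_act]. *)
Lemma equivt_act n x (U : 'M[C]_n) : deg x = n -> U \is unitarymx ->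
  equivt x (act U x).
Proof. by move=> e; subst n => uU; exists U. Qed.

Lemma equivt_sym x y : equivt x y -> equivt y x.
Proof.
move=> [U uU <-].
have uV : invmx U \is unitarymx by rewrite (invmx_unitary uU) trmxC_unitary.
have h := equivt_act (n := deg x) (deg_act uU) uV.
by rewrite -(actM uV uU) (mulVmx (unitarymx_unit uU)) act1 in h.
Qed.

Lemma equivt_trans y x z : equivt x y -> equivt y z -> equivt x z.
Proof.
move=> [U uU xy] [V uV yz]; have dxy : deg x = deg y by rewrite -xy deg_act.
rewrite -yz; clear z yz; move: V uV; rewrite -dxy => V uV.
by rewrite -xy -(actM uV uU); exact: equivt_act (erefl _) (mul_unitarymx uV uU).
Qed.

Lemma tsumP f x y c : Cstar f ->
  opnorm (f (x \oplus y)) <= c <-> opnorm (f x) <= c /\ opnorm (f y) <= c.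
Proof.
move=> [_ _ fsum _].
rewrite -(opnorm_fval f (deg_tsum x y)) fsum.
exact: opnorm_mxdsum.
Qed.

(* [f y] is unitarily equivalent to the direct sum of the [f t]. *)
Lemma decomposition y : exists ts : seq T,
  [/\ forall t, List.In t ts -> irreducible t,
      forall t, List.In t ts -> (deg t < deg y)%N \/ equivt t y
    & forall f, Cstar f -> forall c,
      opnorm (f y) <= c <-> forall t, List.In t ts -> opnorm (f t) <= c].
Proof.
have [n] := ubnP (deg y); elim: n y => // n IH y; rewrite ltnS => yn.
have [iy|/contrapT[a [b [V uV Vy]]]] := pselect (irreducible y).
  exists [:: y]; split=> [t [<-|[]]|t [<-|[]]|f fC c] //.
    by right; exact: equivt_refl.
  by split=> [h t [<-|[]]//|h]; apply: h; left.
have dy : deg y = (deg a + deg b)%N by rewrite -(deg_act uV) Vy deg_tsum.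
have ay : (deg a < deg y)%N by rewrite dy -[ltnLHS]addn0 ltn_add2l deg_gt0.
have byy : (deg b < deg y)%N by rewrite dy -[ltnLHS]add0n ltn_add2r deg_gt0.
have [la [la1 la2 la3]] := IH _ (leq_trans ay yn).
have [lb [lb1 lb2 lb3]] := IH _ (leq_trans byy yn).
exists (la ++ lb); split.
- by move=> t /List.in_app_iff[/la1|/lb1].
- move=> t /List.in_app_iff[/la2|/lb2] [h|/deg_equivt h]; left.
  + exact: ltn_trans h ay.
  + by rewrite h.
  + exact: ltn_trans h byy.
  + by rewrite h.
move=> f fC c; rewrite (@opnorm_equivt f y (a \oplus b))//; last by exists V.
rewrite (tsumP _ _ _ fC) (la3 _ fC) (lb3 _ fC); split.
  by move=> [ha hb] t /List.in_app_iff[/ha|/hb].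
by move=> h; split=> t ht; apply: h; apply/List.in_app_iff; [left|right].
Qed.

Lemma irreducible_subt x t : irreducible t -> subt x t -> equivt x t.
Proof.
move=> it [//|[a [b [xa [V uV Vt]]]]]; case: it; by exists a, b, V.
Qed.

Lemma irreducible_disjt s t : irreducible s -> irreducible t ->
  equivt s t \/ disjt s t.
Proof.
move=> is_ it; have [|h] := pselect (equivt s t); [by left|right].
move=> [a [/(irreducible_subt is_) as_ /(irreducible_subt it) at_]].
by apply: h; exact: equivt_trans (equivt_sym as_) at_.
Qed.

Lemma Cstar_tsub f g : Cstar f -> Cstar g -> Cstar (tsub f g).
Proof.
move=> [fc fa fs [M fM]] [gc ga gs [N gN]]; split.
- move=> n; rewrite fvalB => x.
  have h1 := fc n x; have h2 := gc n x.
  exact: (cvgB h1 h2).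
- move=> x U uU; rewrite fvalB (fa _ _ uU) (ga _ _ uU) /tsub /mxact.
  rewrite mulmxBr mulmxBl; reflexivity.
- move=> x y; rewrite fvalB fs gs /tsub /mxdsum opp_block_mx add_block_mx.
  rewrite !subr0; reflexivity.
exists (M + N) => _ [x _ <-]; rewrite /tsub.
by apply: le_trans (opnormB _ _) (lerD _ _); [apply: fM|apply: gN]; exists x.
Qed.

Lemma Cstar0_tsub f g : Cstar0 T f -> Cstar0 T g -> Cstar0 T (tsub f g).
Proof.
move=> [fC f0] [gC g0]; split; first exact: Cstar_tsub.
move=> e e0; have e2 : 0 < e / 2 by rewrite divr_gt0.
have [K [KX cK fK]] := f0 _ e2; have [L [LX cL gL]] := g0 _ e2.
exists (K `|` L); split.
- by move=> x [/KX|/LX].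
- exact: compactU.
move=> t [tX /not_orP[tK tL]]; rewrite (splitr e) /tsub.
by apply: le_trans (opnormB _ _) (lerD _ _); [exact: fK|exact: gL].
Qed.

Lemma Cstar_ub f : Cstar f -> exists2 M, 1 <= M & forall x, opnorm (f x) <= M.
Proof.
move=> [_ _ _ [M fM]]; exists (Num.max 1 M); first by rewrite le_max lexx.
by move=> x; rewrite le_max fM ?orbT//; exists x.
Qed.

End TowerFunctions.

(** If P failed on K, the sets B such that P holds on K minus B would form a proper filter
    containing K. At a cluster point, the complement of a neighbourhood with property P belongs to
    it, which is absurd. *)
Lemma compact_ind (X : topologicalType) (K : set X) (P : set X -> Prop) :
  compact K -> P set0 -> (forall A B, P A -> P B -> P (A `|` B)) ->
  (forall A B, A `<=` B -> P B -> P A) ->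
  (forall x, K x -> exists2 A, nbhs x A & P A) -> P K.
Proof.
move=> cK P0 PU PS Ploc; apply: contrapT => nPK.
pose F : set_system X := [set B | P (K `\` B)].
have FF : ProperFilter F.
  split; first by rewrite /F /= setD0.
  split; first by rewrite /F /= setDT.
    by move=> A B FA FB; rewrite /F /= setDIr; exact: PU.
  by move=> A B AB; apply: PS; exact: setDS.
have [|x [Kx clx]] := cK F FF; first by rewrite /F /= setDv.
have [A Ax PA] := Ploc x Kx.
have FA : F (~` A) by rewrite /F /= setDE setCK; apply: PS PA; exact: subIsetr.
by have [z [nAz Az]] := clx _ _ FA Ax.
Qed.

Lemma subr_addB (V : zmodType) (a f h p : V) : a - (f + h - p) = a - h - (f - p).
Proof. by rewrite opprB opprD opprB !addrA [LHS]addrAC (addrAC a p). Qed.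

(** * Separation in a subalgebra *)

Section Subalgebra.
Variables (R : realType) (T : tower R) (E : set (tfun T)).
Hypothesis saE : star_subalgebra (Cstar0 T) E.
Local Notation C := (Cplx R).
Local Notation r2c := (real_complex R : R -> C).
Implicit Types (x y s t : T) (f g h u v : tfun T).

Lemma subalg_Cstar f : E f -> Cstar f.
Proof. by case/(subalg_sub saE). Qed.

Lemma subalg_scaler c f : E f -> E (fun x => r2c c *: f x).
Proof. exact: (subalgZ saE). Qed.

Lemma subalg_add f g : E f -> E g -> E (fun x => f x + g x).
Proof. exact: (subalgD saE). Qed.

Lemma subalg_mul f g : E f -> E g -> E (fun x => f x *m g x).
Proof. exact: (subalgM saE). Qed.

Lemma subalg_subr f g : E f -> E g -> E (fun x => f x - g x).
Proof.
move=> Ef Eg; have := subalg_add Ef (subalgZ saE (-1) Eg).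
by congr E; apply: functional_extensionality_dep => x; rewrite /tscale scaleN1r.
Qed.

Lemma subalg_gram f : E f -> E (fun x => gram (f x)).
Proof. by move=> Ef; exact: subalg_mul (subalg_adj saE Ef) Ef. Qed.

(** Scalar matrices need not come from E, so an affine polynomial enters only behind a factor from
    E. *)
Lemma subalg_mul_aff a b f g : E f -> E g -> E (fun x => f x *m affmx a b (g x)).
Proof.
move=> Ef Eg; have := subalg_add (subalg_scaler a Ef) (subalg_scaler b (subalg_mul Ef Eg)).
congr E; apply: functional_extensionality_dep => x.
by rewrite /affmx mulmxDr mul_mx_scalar scalemxAr.
Qed.

Lemma subalg_mul_affX a b k f g : E f -> E g -> E (fun x => f x *m affmx a b (g x) ^+ k).
Proof.
elim: k f => [|k IH] f Ef Eg.
  move: (Ef); congr E; apply: functional_extensionality_dep => x.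
  rewrite expr0; exact: esym (mulmx1 _).
have := IH _ (subalg_mul_aff a b Ef Eg) Eg; congr E.
by apply: functional_extensionality_dep => x; rewrite mxexprS mulmxA.
Qed.

Lemma subalg_peak b f : E f -> E (fun x => peakmx b (f x)).
Proof. by move=> Ef; exact: subalg_mul_affX (subalg_gram Ef) (subalg_gram Ef). Qed.

Lemma subalg_step f : E f -> E (fun x => stepmx (f x)).
Proof.
move=> Ef; have Eg := subalg_gram Ef.
exact: subalg_mul Eg (subalg_mul_aff _ _ Eg Eg).
Qed.

(** The case k = 0 is zero, and passing from k to k + 1 adds a multiple of the Gram matrix times a
    power of an affine polynomial. *)
Lemma subalg_cut N k f : E f -> E (fun x => cutmx N k (f x)).
Proof.
move=> Ef; elim: k => [|k IH].
  have := subalg0 saE; congr E; apply: functional_extensionality_dep => x.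
  rewrite /cutmx expr0; exact: esym (subrr _).
have Eg := subalg_gram Ef; have EgX := subalg_mul_affX 1 (- N^-1) k Eg Eg.
have := subalg_add IH (subalg_scaler N^-1 EgX); congr E.
apply: functional_extensionality_dep => x; rewrite /cutmx mxexprS.
rewrite {3}/affmx mulmxDl mul_scalar_mx (rmorph1 (real_complex R)) scale1r.
by rewrite opprD addrA (rmorphN (real_complex R)) scaleNr mulNmx opprK scalemxAl.
Qed.

Lemma opnorm_near1 g t e : Cstar g -> g t = 1%:M -> 0 < e ->
  \forall x \near t, opnorm (1%:M - g x) < e.
Proof.
move=> gC gt e0.
have ot : \forall x \near t, deg x = deg t.
  by apply: open_nbhs_nbhs; split => //; exact: (open_deg T [set deg t]).
have ft : fval (deg t) g t = 1%:M by rewrite /fval conform_mx_id.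
have := Cstar_near t gC e0; rewrite ft.
move: ot; apply: filterS2 => x xt.
have -> // : opnorm (1%:M - fval (deg t) g x) = opnorm (1%:M - g x).
by rewrite -xt /fval conform_mx_id.
Qed.

Lemma opnorm_near0 g y e : Cstar g -> g y = 0 -> 0 < e ->
  \forall x \near y, opnorm (g x) < e.
Proof.
move=> gC gy e0; have /cvgrPdist_lt/(_ _ e0) := opnorm_continuous gC (x := y).
rewrite /= gy opnorm0; apply: filterS => x.
by rewrite sub0r normrN ger0_norm ?opnorm_ge0.
Qed.

Lemma gram0 n : gram (0 : 'M[C]_n) = 0.
Proof. exact: mulmx0. Qed.

Lemma peakmx0 n b : peakmx b (0 : 'M[C]_n) = 0.
Proof. by rewrite /peakmx gram0 mul0mx. Qed.

Lemma peakmx1 n b : peakmx b (1%:M : 'M[C]_n) = 1%:M.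
Proof.
rewrite /peakmx; have -> : gram (1%:M : 'M[C]_n) = 1%:M.
  by rewrite /gram mulmx1 trmx1 map_mx1.
have -> : affmx (1 + b.+1%:R^-1) (- b.+1%:R^-1) (1%:M : 'M[C]_n) = 1.
  rewrite /affmx scalemx1 -raddfD -rmorphD addrK rmorph1; reflexivity.
rewrite expr1n; exact: mulmx1.
Qed.

(* The polynomial [y (1 - (y - 1) / b) ^ b] attains its maximum 1 over
   [0, 1 + b] at [y = 1]: contractivity is gained while g(t) = 1 is kept. *)
Lemma normalize g t : E g -> g t = 1%:M -> exists h,
  [/\ E h, forall x, opnorm (h x) <= 1, h t = 1%:M
    & forall x, g x = 0 -> h x = 0].
Proof.
move=> Eg gt; have [M M1 gM] := Cstar_ub (subalg_Cstar Eg).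
have [b Mb] : exists b : nat, M ^+ 2 <= 1 + b.+1%:R.
  exists (Num.truncn (M ^+ 2)); apply/ltW.
  by apply: (lt_le_trans (truncnS_gt _)); rewrite lerDr.
exists (fun x => peakmx b (g x)); split.
- exact: subalg_peak.
- move=> x; apply: opnorm_peakmx; apply: le_trans Mb.
  by rewrite ler_pXn2r ?nnegrE ?opnorm_ge0// (le_trans _ M1).
- rewrite gt; exact: peakmx1.
- move=> x ->; exact: peakmx0.
Qed.

(** Off a compact set K a single contraction [g0] with value 1 at t is already small. On the part of
    F in K, finitely many contractions, each small near one point, are multiplied. *)
Lemma separate_point t (F : set T) d : closed F -> F `<=` clcore T -> 0 < d ->
  (exists2 g, E g & g t = 1%:M) ->
  (forall y, F y -> exists2 g, E g & g t = 1%:M /\ g y = 0) ->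
  exists g, [/\ E g, forall x, opnorm (g x) <= 1, g t = 1%:M
              & forall y, F y -> opnorm (g y) <= d].
Proof.
move=> cF FX d0 [g Eg gt] sep.
have [g0 [Eg0 g01 g0t _]] := normalize Eg gt.
have [_ /(_ _ d0)[K [KX cK g0K]]] := subalg_sub saE Eg0.
have [g1 [Eg1 g11 g1t g1F]] : exists g, [/\ E g, forall x, opnorm (g x) <= 1,
    g t = 1%:M & forall y, (K `&` F) y -> opnorm (g y) <= d].
  have cKF : compact (K `&` F) by exact: compact_closedI.
  pose P (A : set T) := exists g, [/\ E g, forall x, opnorm (g x) <= 1,
    g t = 1%:M & forall y, A y -> opnorm (g y) <= d].
  apply: (@compact_ind _ _ P) => //.
  - by exists g0; split.
  - move=> A B [f [Ef f1 ft fA]] [h [Eh h1 ht hB]].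
    exists (fun x => f x *m h x); split.
    + exact: subalg_mul.
    + by move=> x; rewrite -[1]mulr1; exact: opnormM_le.
    + rewrite ft ht; exact: mulmx1.
    + move=> y [/fA fy|/hB hy].
        by rewrite -[d]mulr1; exact: opnormM_le.
      by rewrite -[d]mul1r; exact: opnormM_le.
  - move=> A B AB [f [Ef f1 ft fA]]; exists f; split=> // y /AB; exact: fA.
  move=> y [_ Fy]; have [f Ef [ft fy]] := sep _ Fy.
  have [h [Eh h1 ht h0]] := normalize Ef ft.
  exists [set x | opnorm (h x) < d].
    exact: opnorm_near0 (subalg_Cstar Eh) (h0 _ fy) d0.
  by exists h; split=> // x /= /ltW.
exists (fun x => g0 x *m g1 x); split.
- exact: subalg_mul.
- by move=> x; rewrite -[1]mulr1; exact: opnormM_le.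
- rewrite g0t g1t; exact: mulmx1.
move=> y Fy; have [Ky|nKy] := pselect (K y).
  by rewrite -[d]mul1r; apply: opnormM_le => //; exact: g1F.
by rewrite -[d]mulr1; apply: opnormM_le => //; apply: g0K; split=> //; exact: FX.
Qed.

(** For e <= 1/24 one has 12 e^2 <= e/2, so each [stepmx] halves the bound on the distance to the
    fixed point 0 or 1. *)
Lemma amplify g d : E g -> (forall x, opnorm (g x) <= 1) -> 0 < d -> exists h,
  [/\ E h, forall x, opnorm (1%:M - h x) <= 1,
      forall x, opnorm (g x) <= 24^-1 -> opnorm (h x) <= d
    & forall x, opnorm (1%:M - g x) <= 24^-1 -> opnorm (1%:M - h x) <= d].
Proof.
move=> Eg g1 d0; pose it k : tfun T := fun x => iter k (fun A => stepmx A) (g x).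
have Eit k : E (it k) by elim: k => // k IH; exact: subalg_step.
have it1 k x : opnorm (it k x) <= 1.
  by elim: k => [|k IH]; [exact: g1|exact: opnorm_stepmx].
have half k (e : R) : e <= 2^-1 ^+ k / 24 -> 0 <= e -> 12 * e ^+ 2 <= 2^-1 ^+ k.+1 / 24.
  have : 2^-1 ^+ k <= 1 :> R by apply: exprn_ile1; lra.
  have : 0 <= 2^-1 ^+ k :> R by rewrite exprn_ge0.
  rewrite (exprS 2^-1) expr2; move: (2^-1 ^+ k) => z z0 z1 ez e0.
  have := ler_pM e0 e0 ez ez; have := ler_piMr z0 z1; lra.
have pow0 k : 0 <= 2^-1 ^+ k / 24 :> R by rewrite divr_ge0// exprn_ge0.
have near0 k x : opnorm (g x) <= 24^-1 -> opnorm (it k x) <= 2^-1 ^+ k / 24.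
  move=> gx; elim: k => [|k IH]; first by rewrite expr0 mul1r.
  exact: le_trans (stepmx_near0 (it1 k x) IH) (half _ _ (lexx _) (pow0 k)).
have near1 k x : opnorm (1%:M - g x) <= 24^-1 ->
    opnorm (1%:M - it k x) <= 2^-1 ^+ k / 24.
  move=> gx; elim: k => [|k IH]; first by rewrite expr0 mul1r.
  exact: le_trans (stepmx_near1 (it1 k x) IH) (half _ _ (lexx _) (pow0 k)).
have [k kd] : exists k : nat, 2^-1 ^+ k.+1 / 24 <= d.
  have [k hk] : exists k : nat, d^-1 < k%:R.
    by exists (Num.truncn d^-1).+1; exact: truncnS_gt.
  exists k; have k0 : (0 : R) < k%:R by rewrite (lt_trans _ hk)// invr_gt0.
  have dk : k%:R^-1 < d by rewrite -[d]invrK ltf_pV2 ?posrE ?invr_gt0.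
  apply: le_trans (ltW dk); rewrite exprVn.
  apply: (@le_trans _ _ (2 ^+ k.+1)^-1).
    rewrite ler_piMr ?invr_ge0 ?exprn_ge0//.
    by rewrite invf_le1// ler1n.
  rewrite lef_pV2 ?posrE ?exprn_gt0//.
  by rewrite -natrX ler_nat (leq_trans (leqnSn k))// ltnW// ltn_expl.
(* At least one step is taken, since [g] itself is only known to be a contraction while values of
   [stepmx] also satisfy the bound on 1 - h. *)
exists (it k.+1); split.
- exact: Eit.
- by move=> x; exact: (opnorm_1Bstepmx (it1 k x)).
- by move=> x gx; exact: le_trans (near0 k.+1 x gx) kd.
- by move=> x gx; exact: le_trans (near1 k.+1 x gx) kd.
Qed.

(** Unions are served by f + h - f h, which equals f + (1 - f) h and whose difference from 1 is (1 -
    f)(1 - h). Hence the bound 1 is imposed on 1 - h rather than on h. *)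
Lemma separate_compact (K F : set T) : compact K -> closed F -> F `<=` clcore T ->
  (forall t, K t -> exists2 g, E g & g t = 1%:M) ->
  (forall t y, K t -> F y -> exists2 g, E g & g t = 1%:M /\ g y = 0) ->
  forall d, 0 < d -> exists h,
    [/\ E h, forall x, opnorm (1%:M - h x) <= 1,
        forall x, K x -> opnorm (1%:M - h x) <= d
      & forall y, F y -> opnorm (h y) <= d].
Proof.
move=> cK cF FX good sep.
pose P (A : set T) := forall d, 0 < d -> exists h,
    [/\ E h, forall x, opnorm (1%:M - h x) <= 1,
        forall x, A x -> opnorm (1%:M - h x) <= d
      & forall y, F y -> opnorm (h y) <= d].
apply: (@compact_ind _ _ P) => //.
- move=> d d0; exists (tzero (T := T)); split.
  + exact: (subalg0 saE).
  + move=> x; rewrite /tzero subr0; exact: opnorm1_le.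
  + by [].
  + by move=> y _; rewrite /tzero opnorm0 ltW.
- move=> A B PA PB d d0; have d2 : 0 < d / 2 by rewrite divr_gt0.
  have [f [Ef f1 fA fF]] := PA _ d2; have [h [Eh h1 hB hF]] := PB _ d2.
  exists (fun x => f x + h x - f x *m h x).
  have kE x : 1%:M - (f x + h x - f x *m h x) = (1%:M - f x) *m (1%:M - h x).
    rewrite mulmxBl mul1mx mulmxBr mulmx1; exact: subr_addB.
  split.
  + exact: subalg_subr (subalg_add Ef Eh) (subalg_mul Ef Eh).
  + by move=> x; rewrite kE; have := opnormM_le (f1 x) (h1 x); rewrite mulr1.
  + move=> x [/fA fx|/hB hx]; rewrite kE.
      rewrite -[d]mulr1; apply: opnormM_le; last exact: h1.
      by apply: le_trans fx _; rewrite ler_pdivrMr// ler_peMr ?(ltW d0)// ler1n.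
    rewrite -[d]mul1r; apply: opnormM_le; first exact: f1.
    by apply: le_trans hx _; rewrite ler_pdivrMr// ler_peMr ?(ltW d0)// ler1n.
  move=> y Fy.
  have e : f y + h y - f y *m h y = f y + (1%:M - f y) *m h y.
    by rewrite mulmxBl mul1mx addrA.
  rewrite e (splitr d); apply: le_trans (opnormD _ _) (lerD (fF _ Fy) _).
  rewrite -[d / 2]mul1r; exact: opnormM_le (f1 y) (hF _ Fy).
- move=> A B AB PB d d0; have [h [Eh h1 hB hF]] := PB _ d0.
  by exists h; split=> // x /AB; exact: hB.
(* The threshold 1/24 fixes the neighbourhood before [d] is given; [amplify] then reaches every
   [d]. *)
move=> t Kt; have t0 : (0 : R) < 24^-1 by rewrite invr_gt0.
have [g [Eg g1 gt gF]] := separate_point cF FX t0 (good _ Kt) (fun y => sep t y Kt).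
exists [set x | opnorm (1%:M - g x) < 24^-1].
  exact: opnorm_near1 (subalg_Cstar Eg) gt t0.
move=> d d0; have [h [Eh h1 h0 hh1]] := amplify Eg g1 d0.
exists h; split; [exact: Eh|exact: h1| |] => [x /= /ltW gx|y Fy].
  exact: hh1 gx.
exact: h0 (gF _ Fy).
Qed.

End Subalgebra.

Lemma opprD_addACA (V : zmodType) (A B a b : V) : A + B - (a + b) = A - a + (B - b).
Proof. by rewrite opprD addrACA. Qed.

(** * Approximation of scalar functions *)

Section Approximation.
Variables (R : realType) (T : tower R) (E : set (tfun T)).
Hypothesis saE : star_subalgebra (Cstar0 T) E.
Local Notation C := (Cplx R).
Local Notation r2c := (real_complex R : R -> C).
Implicit Types (x y s t : T) (f g h u v w z : tfun T).

Lemma closed_ub (f : T -> R) c : continuous f -> closed [set x | f x <= c].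
Proof.
move=> cf; apply: (@closed_comp _ _ f [set r | r <= c]) => [x _|]; first exact: cf.
exact: closed_le.
Qed.

Lemma closed_lb (f : T -> R) c : continuous f -> closed [set x | c <= f x].
Proof.
move=> cf; apply: (@closed_comp _ _ f [set r | c <= r]) => [x _|]; first exact: cf.
exact: closed_ge.
Qed.

Lemma closed_deg (P : set nat) : closed [set x : T | P (deg x)].
Proof. by rewrite -[X in closed X]setCK; apply: open_closedC; exact: (open_deg T (~` P)). Qed.

Lemma scalar0 n : (r2c 0)%:M = 0 :> 'M[C]_n.
Proof. rewrite (rmorph0 (real_complex R)); exact: raddf0. Qed.

Lemma scalar1 n : (r2c 1)%:M = 1%:M :> 'M[C]_n.
Proof. by rewrite (rmorph1 (real_complex R)). Qed.

Lemma scalar1B n (A : 'M[C]_n) b : A - (r2c b)%:M = A - 1%:M + (r2c (1 - b))%:M.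
Proof.
rewrite (rmorphB (real_complex R) 1 b) raddfB [(r2c 1)%:M]scalar1 addrA subrK.
reflexivity.
Qed.

Lemma opnorm_shift n (A B : 'M[C]_n) (a b : R) :
  opnorm (A + B - (r2c (a + b))%:M) <=
  opnorm (A - (r2c a)%:M) + opnorm (B - (r2c b)%:M).
Proof.
have -> : A + B - (r2c (a + b))%:M = (A - (r2c a)%:M) + (B - (r2c b)%:M).
  rewrite rmorphD raddfD; exact: opprD_addACA.
exact: opnormD.
Qed.

(* Layer cake: [eta] is approximated by the mean of the elements [G j], where
   [G j] is close to 1 on {eta >= (j + 1) / m} and to 0 on {eta <= j / m}; at
   each point at most one of them is neither. *)
Lemma scalar_multiplier (Y : set T) (eta : T -> R) :
  closed Y -> Y `<=` clcore T -> continuous eta ->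
  (forall y, 0 <= eta y <= 1) ->
  (forall a, 0 < a -> compact (Y `&` [set y | a <= eta y])) ->
  (forall t, Y t -> 0 < eta t -> exists2 g, E g & g t = 1%:M) ->
  (forall t y, Y t -> Y y -> eta y < eta t ->
     exists2 g, E g & g t = 1%:M /\ g y = 0) ->
  forall d, 0 < d -> exists2 h, E h &
    forall y, Y y -> opnorm (h y - (r2c (eta y))%:M) <= d.
Proof.
move=> cY YX ceta eta01 cK good sep d d0.
have d2 : 0 < d / 2 by rewrite divr_gt0.
(* Taken above 4/d so that the total error m d/2 + 2 of the sum is at most m d. *)
pose m := (Num.truncn (4 / d)).+1.
have m0 : (0 : R) < m%:R by rewrite ltr0n.
have md : 4 / d < m%:R by exact: truncnS_gt.
have layer (j : nat) : exists g, [/\ E g, forall x, opnorm (1%:M - g x) <= 1,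
    forall y, Y y -> j.+1%:R / m%:R <= eta y -> opnorm (1%:M - g y) <= d / 2
  & forall y, Y y -> eta y <= j%:R / m%:R -> opnorm (g y) <= d / 2].
  have jm : 0 < j.+1%:R / m%:R :> R by rewrite divr_gt0// ltr0n.
  have jm' : j%:R / m%:R < j.+1%:R / m%:R :> R by rewrite ltr_pM2r ?invr_gt0// ltr_nat.
  pose F := Y `&` [set y | eta y <= j%:R / m%:R].
  have cF : closed F.
    exact: closedI cY (closed_ub ceta).
  have FX : F `<=` clcore T by move=> y [/YX].
  have goodK t : (Y `&` [set y | j.+1%:R / m%:R <= eta y]) t ->
      exists2 g, E g & g t = 1%:M.
    by move=> [Yt te]; exact: good Yt (lt_le_trans jm te).
  have sepK t y : (Y `&` [set y | j.+1%:R / m%:R <= eta y]) t -> F y ->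
      exists2 g, E g & g t = 1%:M /\ g y = 0.
    move=> [Yt te] [Yy ye].
    exact: sep Yt Yy (le_lt_trans ye (lt_le_trans jm' te)).
  have [g [Eg g1 gK gF]] := separate_compact saE (cK _ jm) cF FX goodK sepK d2.
  exists g; split; [exact: Eg|exact: g1| |] => y Yy ye.
    by apply: gK; split.
  by apply: gF; split.
have [G GP] := choice layer.
pose S := fix S k : tfun T :=
  if k is k'.+1 then fun x => S k' x + G k' x else fun x => 0.
have ES k : E (S k).
  elim: k => [|k IH]; first exact: (subalg0 saE).
  by apply: (subalg_add saE) IH _; case: (GP k).
exists (fun x => r2c m%:R^-1 *: S m x); first exact: subalg_scaler (ES m).
move=> y Yy; have /andP[e0 e1] := eta01 y; pose s := m%:R * eta y.
have sE : eta y = s / m%:R by rewrite /s mulrAC divff ?mul1r// gt_eqF.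
(* The first k layers sum to about min(k, s). Each costs d/2, except the one with j < s < j + 1,
   which costs 2; the indicator tells whether s has been passed. *)
have claim k : opnorm (S k y - (r2c (Num.min k%:R s))%:M) <=
    k%:R * (d / 2) + (s < k%:R)%R%:R * 2.
  elim: k => [|k IH].
    have s0 : 0 <= s by rewrite mulr_ge0// ltW.
    have ms : Num.min 0 s = 0 by rewrite min_l.
    have ns : (s < 0) = false by rewrite ltNge s0.
    rewrite ms ns !mul0r addr0 scalar0 subr0.
    by rewrite [S 0%N y](_ : _ = 0)// opnorm0.
  have [_ g1 gK gF] := GP k.
  have step a b c c' : Num.min k%:R s = a -> Num.min k.+1%:R s = a + b ->
      opnorm (G k y - (r2c b)%:M) <= c -> (s < k%:R)%R%:R * 2 + c <= c' ->
      opnorm (S k.+1 y - (r2c (Num.min k.+1%:R s))%:M) <= k%:R * (d / 2) + c'.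
    move=> ea eb hc hc'; rewrite eb; apply: le_trans (opnorm_shift _ _ _ _) _.
    rewrite ea in IH; apply: le_trans (lerD IH hc) _.
    by rewrite -[leLHS]addrA lerD2l.
  have kd : k.+1%:R * (d / 2) = k%:R * (d / 2) + d / 2.
    by rewrite -natr1 mulrDl mul1r.
  have [sk|sk] := leP s k%:R.
    have sk1 : s < k.+1%:R by rewrite (le_lt_trans sk)// ltr_nat.
    rewrite sk1 kd -[leRHS]addrA.
    apply: (step s 0 (d / 2)).
    - by rewrite min_r.
    - by rewrite addr0 min_r// ltW.
    - rewrite scalar0 subr0; apply: gF Yy _.
      by rewrite sE ler_pM2r// invr_gt0.
    - by rewrite [leRHS]addrC lerD2r ler_pM2r// ler_nat; case: (s < _).
  have nsk : (s < k%:R) = false by rewrite ltNge (ltW sk).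
  have [sk1|sk1] : k.+1%:R <= s \/ s < k.+1%:R by case: leP; [left|right].
    have nsk1 : (s < k.+1%:R) = false by rewrite ltNge sk1.
    rewrite nsk1 mul0r addr0 kd.
    apply: (step k%:R 1 (d / 2)).
    - by rewrite min_l// ltW.
    - by rewrite min_l// -natr1.
    - rewrite scalar1 opnorm_distC; apply: gK Yy _.
      by rewrite sE ler_pM2r// invr_gt0.
    - by rewrite nsk mul0r add0r.
  rewrite sk1 mul1r kd -[leRHS]addrA.
  apply: (step k%:R (s - k%:R) 2).
  - by rewrite min_l// ltW.
  - by rewrite min_r ?(ltW sk1)// addrC subrK.
  - have -> : G k y - (r2c (s - k%:R))%:M =
        (G k y - 1%:M) + (r2c (1 - (s - k%:R)))%:M by exact: scalar1B.
    apply: le_trans (opnormD _ _) _; rewrite -[2]/(1 + 1); apply: lerD.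
      by rewrite opnorm_distC; exact: g1.
    apply: le_trans (opnorm_scalar_le _ _) _.
    have k1 : s - k%:R < 1 by rewrite ltrBlDr nat1r.
    have k2 : 0 < s - k%:R by rewrite subr_gt0.
    by rewrite ger0_norm; lra.
  by rewrite nsk mul0r add0r lerDr ltW.
have sm : s <= m%:R by rewrite ger_pMr.
have -> : r2c m%:R^-1 *: S m y - (r2c (eta y))%:M =
    r2c m%:R^-1 *: (S m y - (r2c (Num.min m%:R s))%:M).
  rewrite scalerBr scale_scalar_mx -rmorphM min_r// sE mulrC; reflexivity.
apply: le_trans (opnormZr _ _) _; rewrite ger0_norm ?invr_ge0 ?(ltW m0)//.
rewrite mulrC ler_pdivrMr//; apply: le_trans (claim m) _.
have h2 : (s < m%:R)%R%:R * 2 <= 2 :> R by case: (s < _); rewrite ?mul1r ?mul0r.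
have h4 : 4 < d * m%:R by rewrite -ltr_pdivrMl// mulrC.
clear - h2 h4; move: (_ * 2) h2 h4 => a; move: m%:R => b; lra.
Qed.

End Approximation.

Lemma blend_identity (K : pzRingType) (L : lmodType K) (c : K) (p q r : L) :
  (1 - c) *: p + c *: (p - q) - (r - c *: q) = p - r.
Proof.
by rewrite scalerBl scale1r scalerBr addrA subrK opprB addrA subrK.
Qed.

(** * Density *)

Section Density.
Variables (R : realType) (T : tower R) (E : set (tfun T)).
Hypothesis saE : star_subalgebra (Cstar0 T) E.
Local Notation C := (Cplx R).
Local Notation r2c := (real_complex R : R -> C).
Implicit Types (x y s t : T) (f g h u v w z : tfun T).

Lemma core_clcore t : irreducible t -> clcore T t.
Proof. exact: subset_closure. Qed.

(** Off a compact set f is at most a/2, so the level set is a closed part of that compact set. *)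
Lemma compact_level f a (Y : set T) : Cstar0 T f -> closed Y -> Y `<=` clcore T ->
  0 < a -> compact (Y `&` [set y | a <= opnorm (f y)]).
Proof.
move=> [fC f0] cY YX a0; have [K [KX cK fK]] := f0 _ (divr_gt0 a0 (ltr0n R 2)).
apply: (subclosed_compact _ cK).
  exact: closedI cY (closed_lb (opnorm_continuous fC)).
move=> y [Yy /= ay]; apply: contrapT => nKy.
have := le_trans ay (fK _ (conj (YX _ Yy) nKy)).
by rewrite leNgt ltr_pdivrMr// ltr_pMr// ltr1n.
Qed.

Lemma compact_deg (K : set T) : compact K -> exists n, forall x, K x -> (deg x <= n)%N.
Proof.
move=> cK; pose P (A : set T) := exists n, forall x, A x -> (deg x <= n)%N.
apply: (@compact_ind _ _ P cK).
- by exists 0%N.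
- move=> A B [n An] [m Bm]; exists (maxn n m) => x [/An|/Bm] h.
    by rewrite leq_max h.
  by rewrite leq_max h orbT.
- by move=> A B AB [n Bn]; exists n => x /AB; exact: Bn.
move=> x _; exists [set y | deg y = deg x]; last by exists (deg x) => y /= ->.
by apply: open_nbhs_nbhs; split => //; exact: (open_deg T [set deg x]).
Qed.

Lemma irreducible_equivt s t : irreducible s -> equivt s t -> irreducible t.
Proof.
move=> is_ st [a [b [V uV Vt]]]; apply: is_.
have [|W uW Ws] := equivt_trans st (_ : equivt t (a \oplus b)); first by exists V.
by exists a, b, W.
Qed.

(** Separation from a whole list is needed because the list will consist of the components of a
    reducible element. The empty list yields some g with g t = 1. *)
Hypothesis sepE : forall t, irreducible t -> (forall g, E g -> g t = 0) \/
  forall ss : seq T, (forall s, List.In s ss -> irreducible s /\ ~ equivt s t) ->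
    exists2 g, E g & g t = 1%:M /\ forall s, List.In s ss -> g s = 0.

(** A cutoff, used with [a] the distance from w to a local approximant in units of e/2 and [b] the
    norm of w in units of e. Depending on norms only, it is constant on equivalence classes. *)
Definition ramp (a b : R) : R := Num.max 0 (Num.min 1 (Num.min (2 - a) (b - 2))).

Lemma ramp01 a b : 0 <= ramp a b <= 1.
Proof. by rewrite /ramp le_max lexx ge_max ler01 ge_min lexx. Qed.

Lemma ramp_gt0 a b : 0 < ramp a b -> a < 2 /\ 2 < b.
Proof.
by rewrite /ramp lt_max ltxx /= !lt_min ltr01 /= !subr_gt0 => /andP[].
Qed.

Lemma ramp1 a b : a <= 1 -> 3 <= b -> ramp a b = 1.
Proof.
move=> a1 b3; rewrite /ramp [Num.min 1 _]min_l ?max_r//.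
by rewrite le_min; apply/andP; split; lra.
Qed.

Lemma ramp_continuous (f g : T -> R) : continuous f -> continuous g ->
  continuous (fun x => ramp (f x) (g x)).
Proof.
move=> cf cg x; have c k : {for x, continuous (fun=> k : R)} by exact: cvg_cst.
have cf2 : {for x, continuous (fun x => 2 - f x)} by exact: cvgB (c 2) (cf x).
have cg2 : {for x, continuous (fun x => g x - 2)} by exact: cvgB (cg x) (c 2).
exact: continuous_max (c 0) (continuous_min (c 1) (continuous_min cf2 cg2)).
Qed.

(** A convex combination of p and q; where nothing is known about q, its weight [eta] is zero. *)
Lemma blend_bound (eta p q e d : R) : 0 <= eta <= 1 -> 0 <= p -> 0 <= q -> 0 <= e ->
  (0 < eta -> q <= e) -> (1 - eta) * p + eta * q + d <= Num.max p e + d.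
Proof.
move=> /andP[e0 e1] p0 q0 ee0 qe; rewrite lerD2r.
have pm : p <= Num.max p e by rewrite le_max lexx.
have em : e <= Num.max p e by rewrite le_max lexx orbT.
move: (Num.max p e) pm em => mx pm em.
have [->|eta0] := eqVneq eta 0; first by rewrite subr0 mul1r mul0r addr0.
have etap : 0 < eta by rewrite lt_def eta0.
have := qe etap; nra.
Qed.

(** With the scalar [eta] in place of H this would be interpolation between Z and V; the replacement
    costs d M. *)
Lemma blend_norm n (W Z V H : 'M[C]_n) (eta d M : R) : 0 <= eta <= 1 ->
  opnorm (H - (r2c eta)%:M) <= d -> opnorm (V - Z) <= M ->
  opnorm (W - (Z + H *m (V - Z))) <=
  (1 - eta) * opnorm (W - Z) + eta * opnorm (W - V) + d * M.
Proof.
move=> /andP[e0 e1] Hd VM.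
have -> : W - (Z + H *m (V - Z)) =
    r2c (1 - eta) *: (W - Z) + r2c eta *: (W - V) - (H - (r2c eta)%:M) *m (V - Z).
  rewrite mulmxBl mul_scalar_mx (rmorphB (real_complex R)) (rmorph1 (real_complex R)).
  have -> : W - V = (W - Z) - (V - Z) by rewrite opprB addrA subrK.
  rewrite opprD addrA; exact: esym (blend_identity (r2c eta) _ _ _).
apply: le_trans (opnormB _ _) (lerD _ _); last exact: opnormM_le.
apply: le_trans (opnormD _ _) (lerD _ _).
  by apply: le_trans (opnormZr _ _) _; rewrite ger0_norm// subr_ge0.
by apply: le_trans (opnormZr _ _) _; rewrite ger0_norm.
Qed.

(** Zero approximates w within 3 e off the compact set [K3], and on [K3] local approximants are
    blended in one after another. The fourth e is the blending error. *)
Lemma dimension_step w n e : Cstar0 T w ->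
  (forall t, irreducible t -> exists2 v, E v & v t = w t) -> 0 < e ->
  (forall y, clcore T y -> (deg y < n)%N -> opnorm (w y) <= e) ->
  exists2 z, E z &
    forall y, clcore T y -> (deg y <= n)%N -> opnorm (w y - z y) <= 4 * e.
Proof.
move=> w0 wE e0 wlow; have wC := w0.1.
pose Y := clcore T `&` [set y | (deg y <= n)%N].
have YX : Y `<=` clcore T by move=> y [].
have cX : closed (clcore T) by exact: closed_closure.
have cD : closed [set y : T | (deg y <= n)%N].
  exact: (@closed_deg R T [set k | (k <= n)%N]).
have cY : closed Y by exact: closedI.
(* Norm above e forces degree n; a reducible t would have all its components in smaller degrees,
   where w is at most e. *)
have big t : Y t -> 2 * e < opnorm (w t) -> irreducible t /\ deg t = n.
  move=> [tX /= tn] wt; have et : e < opnorm (w t).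
    by apply: le_lt_trans wt; rewrite ler_pMl// ler1n.
  have dt : deg t = n.
    apply/eqP; rewrite eqn_leq tn /= leqNgt; apply/negP => /(wlow _ tX).
    by rewrite leNgt et.
  split=> //; have [ts [ts1 ts2 /(_ _ wC e)[_ ts3]]] := decomposition t.
  apply: contrapT => nit; move: et; rewrite ltNge => /negP; apply; apply: ts3.
  move=> s /[dup] /ts1 is_ /ts2[st|st].
    by apply: wlow; [exact: core_clcore|rewrite -dt].
  by case: nit; exact: irreducible_equivt is_ st.
have isolate t : Y t -> 2 * e < opnorm (w t) -> forall ss : seq T,
    (forall s, List.In s ss -> irreducible s /\ ~ equivt s t) ->
    exists2 g, E g & g t = 1%:M /\ forall s, List.In s ss -> g s = 0.
  move=> Yt wt; have [it _] := big t Yt wt.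
  (* If E vanished at t, then w(t) = v(t) = 0, against the lower bound on w. *)
  have [tz|//] := sepE it; have [v Ev vt] := wE t it.
  move: wt; rewrite -vt tz// opnorm0 ltNge mulr_ge0 ?ltW//.
pose K3 := Y `&` [set y | 3 * e <= opnorm (w y)].
have cK3 : compact K3 by apply: compact_level => //; rewrite mulr_gt0.
(* Any z0 can be corrected on A without the error elsewhere on Y exceeding the maximum of the old
   error and e, up to d. Quantifying over z0 lets corrections be composed for unions. *)
pose P (A : set T) := forall d, 0 < d -> forall z0, E z0 -> exists2 z, E z &
  forall y, Y y -> opnorm (w y - z y) <= Num.max (opnorm (w y - z0 y)) e + d /\
    (A y -> 3 * e <= opnorm (w y) -> opnorm (w y - z y) <= e + d).
have PK : P K3.
  apply: (@compact_ind _ _ P cK3).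
  - move=> d d0 z0 Ez0; exists z0 => // y Yy; split=> //.
    by rewrite (@le_trans _ _ (Num.max (opnorm (w y - z0 y)) e)) ?le_max ?lexx// lerDl ltW.
  - move=> A B PA PB d d0 z0 Ez0; have d2 : 0 < d / 2 by rewrite divr_gt0.
    have [z1 Ez1 z1P] := PA _ d2 _ Ez0; have [z2 Ez2 z2P] := PB _ d2 _ Ez1.
    exists z2; first exact: Ez2.
    move=> y Yy; have [h1 h1A] := z1P y Yy; have [h2 h2B] := z2P y Yy.
    have maxle (p q r : R) : p <= q + d / 2 -> e <= q ->
        r <= Num.max p e + d / 2 -> r <= q + d.
      move=> pq eq rm; apply: le_trans rm _; rewrite {2}(splitr d) addrA lerD2r.
      by rewrite ge_max pq ler_wpDr// ltW.
    split; first by apply: maxle h2; [exact: h1|rewrite le_max lexx orbT].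
    move=> [Ay|By] wy.
      by apply: maxle h2; [exact: h1A|exact: lexx].
    by apply: le_trans (h2B By wy) _; rewrite lerD2l ler_pdivrMr// ler_pMr// ler1n.
  - move=> A B AB PB d d0 z0 Ez0; have [z Ez zP] := PB d d0 z0 Ez0.
    exists z; first exact: Ez.
    move=> y Yy; have [h1 h2] := zP y Yy; split; first exact: h1.
    by move=> /AB; exact: h2.
  move=> t [Yt /= wt].
  have wt2 : 2 * e < opnorm (w t) by apply: lt_le_trans wt; rewrite ltr_pM2r// ltr_nat.
  have [it dt] := big t Yt wt2; have [v Ev vt] := wE t it.
  have vC := subalg_Cstar saE Ev; have wvC := Cstar_tsub wC vC.
  pose q y := opnorm (tsub w v y).
  (* This is 1 where q <= e/2 and w has norm at least 3 e, and positive only where q < e and that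
     norm exceeds 2 e. *)
  pose eta y := ramp (2 / e * q y) (e^-1 * opnorm (w y)).
  have qe y : (2 / e * q y < 2) = (q y < e).
    by rewrite mulrAC ltr_pdivrMr// ltr_pM2l.
  have we y : (2 < e^-1 * opnorm (w y)) = (2 * e < opnorm (w y)).
    by rewrite mulrC ltr_pdivlMr.
  have ceta : continuous eta.
    apply: ramp_continuous => y; apply: cvgM; (try exact: cvg_cst).
      exact: opnorm_continuous wvC y.
    exact: opnorm_continuous wC y.
  have eta01 y : 0 <= eta y <= 1 by exact: ramp01.
  have cK a : 0 < a -> compact (Y `&` [set y | a <= eta y]).
    move=> a0; have e20 : 0 < 2 * e by rewrite mulr_gt0.
    apply: (subclosed_compact _ (compact_level w0 cY YX e20)).
      exact: closedI cY (closed_lb ceta).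
    move=> y [Yy /= ay]; split=> //=; apply: ltW; rewrite -we.
    by case: (ramp_gt0 (lt_le_trans a0 ay)).
  have good t' : Y t' -> 0 < eta t' -> exists2 g, E g & g t' = 1%:M.
    move=> Yt' /ramp_gt0[_]; rewrite we => wt'.
    by have [//|g Eg [gt _]] := isolate t' Yt' wt' [::]; exists g.
  have sep t' y : Y t' -> Y y -> eta y < eta t' ->
      exists2 g, E g & g t' = 1%:M /\ g y = 0.
    move=> Yt' [_ /= yn] ety.
    have /ramp_gt0[_] : 0 < eta t' by apply: le_lt_trans ety; case/andP: (eta01 y).
    rewrite we => wt'; have [it' dt'] := big t' Yt' wt'.
    (* A component of y equivalent to t' would have degree n, hence be equivalent to y, and [eta]
       would agree at y and t'. So t' can be isolated from all components. *)
    have [ts [ts1 ts2 ts3]] := decomposition y.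
    have [s /[dup] /ts1 is_ /ts2 sy|g Eg [gt gs]] := isolate t' Yt' wt' ts.
      split=> // st'; have ds := deg_equivt st'.
      case: sy => [|sy]; first by rewrite ds dt' ltnNge yn.
      have ty := equivt_trans (equivt_sym st') sy.
      suff ee : eta t' = eta y by rewrite ee ltxx in ety.
      by rewrite /eta /q (opnorm_equivt wvC ty) (opnorm_equivt wC ty).
    exists g; first exact: Eg.
    split; first exact: gt.
    apply: opnorm_eq0; apply/(ts3 _ (subalg_Cstar saE Eg)) => s sts.
    by rewrite gs// opnorm0.
  exists [set y | q y < e / 2].
    apply: opnorm_near0 => //; last by rewrite divr_gt0.
    by rewrite /tsub vt subrr.
  move=> d d0 z0 Ez0; have EvZ := subalg_subr saE Ev Ez0.
  have [M M1 vzM] := Cstar_ub (subalg_Cstar saE EvZ).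
  have M0 : 0 < M by exact: lt_le_trans M1.
  have dM : 0 < d / M by rewrite divr_gt0.
  have [h Eh hP] := scalar_multiplier saE cY YX ceta eta01 cK good sep dM.
  exists (fun y => z0 y + h y *m (v y - z0 y)).
    exact: (subalg_add saE Ez0 (subalg_mul saE Eh EvZ)).
  move=> y Yy; have b := blend_norm (w y) (eta01 y) (hP y Yy) (vzM y).
  rewrite divfK ?gt_eqF// in b; split.
    apply: (le_trans b); apply: blend_bound (eta01 y) _ _ _ _.
    - exact: opnorm_ge0.
    - exact: opnorm_ge0.
    - exact: ltW.
    - by move=> /ramp_gt0[]; rewrite qe => /ltW.
  move=> /= qy wy.
  have e1 : eta y = 1.
    apply: ramp1; last by rewrite mulrC ler_pdivlMr.
    by rewrite mulrAC ler_pdivrMr// mul1r mulrC -ler_pdivlMr// ltW.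
  rewrite e1 subrr mul0r add0r mul1r in b.
  apply: (le_trans b); rewrite lerD2r; apply: ltW; apply: (lt_trans qy).
  by rewrite ltr_pdivrMr// ltr_pMr// ltr1n.
have [z Ez zP] := PK e e0 _ (subalg0 saE).
exists z; first exact: Ez.
move=> y yX yn; have [h1 h2] := zP y (conj yX yn).
have [wy|wy] := leP (3 * e) (opnorm (w y)).
  apply: le_trans (h2 (conj (conj yX yn) wy) wy) _.
  have -> : e + e = 2 * e by ring.
  by rewrite ler_pM2r// ler_nat.
apply: (le_trans h1); rewrite /tzero subr0.
have -> : 4 * e = 3 * e + e by ring.
by rewrite lerD2r ge_max (ltW wy) /= ler_peMl ?(ltW e0)// ler1n.
Qed.

(** Each degree multiplies the error by 4, so lower degrees are treated with e/4. The base case is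
    void as degrees are positive. *)
Lemma bounded_degree_density u : Cstar0 T u ->
  (forall t, irreducible t -> exists2 v, E v & v t = u t) ->
  forall n e, 0 < e -> exists2 v, E v &
    forall y, clcore T y -> (deg y <= n)%N -> opnorm (u y - v y) <= e.
Proof.
move=> u0 uE; elim=> [|n IH] e e0.
  exists (tzero (T := T)); first exact: (subalg0 saE).
  by move=> y _; rewrite leqn0 -[_ == _]negbK -lt0n deg_gt0.
have e4 : 0 < e / 4 by rewrite divr_gt0.
have [v Ev vP] := IH _ e4.
have w0 := Cstar0_tsub u0 (subalg_sub saE Ev).
have wE t : irreducible t -> exists2 v', E v' & v' t = tsub u v t.
  move=> it; have [v' Ev' v't] := uE t it.
  exists (fun x => v' x - v x); first exact: (subalg_subr saE).
  by rewrite /tsub v't.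
have [z Ez zP] := dimension_step (n := n.+1) w0 wE e4 vP.
exists (fun x => v x + z x); first exact: (subalg_add saE).
move=> y yX yn; have := zP y yX yn; rewrite /tsub -addrA -opprD.
by rewrite mulrC divfK.
Qed.

(* The bounds available so far say nothing beyond a given degree. An element e
   of E acting as an approximate unit on u is small from some degree n' on, and
   an approximant of u up to degree n', truncated in norm by a constant chosen
   before n', can then be multiplied by e. *)
Lemma uniform_density u : Cstar0 T u ->
  (forall t, irreducible t -> exists2 v, E v & v t = u t) ->
  forall e, 0 < e -> exists2 v, E v &
    forall y, clcore T y -> opnorm (u y - v y) <= 4 * e.
Proof.
move=> u0 uE e e0; have [uC /(_ _ e0)[K [KX cK uK]]] := u0.
have [M M1 uM] := Cstar_ub uC; have M0 : 0 < M by exact: lt_le_trans M1.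
have [D KD] := compact_deg cK.
have usmall y : clcore T y -> (D < deg y)%N -> opnorm (u y) <= e.
  by move=> yX Dy; apply: uK; split=> // /KD; rewrite leqNgt Dy.
have density := bounded_degree_density u0 uE.
have [v1 Ev1 v1P] := density D e e0.
have [M1' M1'1 v1M] := Cstar_ub (subalg_Cstar saE Ev1).
pose N1 := M1' ^+ 2; have N10 : 0 < N1 by rewrite exprn_gt0// (lt_le_trans _ M1'1).
have bound (f : tfun T) (B : R) x : 1 <= B -> opnorm (f x) <= B ->
    opnorm (f x) ^+ 2 <= B ^+ 2.
  by move=> B1 fB; rewrite ler_pXn2r ?nnegrE ?opnorm_ge0// (le_trans _ B1).
(* Gives N1 / k <= e^2, so that v1 (1 - c1) has norm at most e. *)
pose k := (Num.truncn (N1 / e ^+ 2)).+1.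
have k0 : (0 : R) < k%:R by rewrite ltr0n.
have Nk : N1 / k%:R <= e ^+ 2.
  rewrite ler_pdivrMr// mulrC -ler_pdivrMr ?exprn_gt0//.
  exact/ltW/truncnS_gt.
pose c1 : tfun T := fun x => cutmx N1 k (v1 x).
have Ec1 : E c1 by exact: subalg_cut.
have c1P y := cutmxP k N10 (bound v1 _ y M1'1 (v1M y)).
have v1c1 y : opnorm (v1 y *m (1%:M - c1 y)) <= e.
  have [_ _ _ /(_ isT) h] := c1P y; have := le_trans h Nk.
  by rewrite ler_pXn2r ?nnegrE ?opnorm_ge0// ltW.
(* The truncation level depends on M and e only; it ensures (M + e)^3 / r^2 <= e. *)
pose r := 1 + (M + e) ^+ 3 / e.
have Me0 : 0 < M + e by rewrite addr_gt0.
have r1 : 1 <= r by rewrite lerDl divr_ge0 ?exprn_ge0 ?ltW.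
have r0 : 0 < r by exact: lt_le_trans r1.
have re : (M + e) ^+ 3 / r ^+ 2 <= e.
  rewrite ler_pdivrMr ?exprn_gt0// mulrC -ler_pdivrMr//.
  apply: (@le_trans _ _ r); first by rewrite lerDr.
  by rewrite expr2 ler_peMr// ltW.
have er0 : 0 < e / r by rewrite divr_gt0.
have [_ /(_ _ er0)[L [LX cL c1L]]] := subalg_sub saE Ec1.
have [D' LD'] := compact_deg cL; pose n := maxn D D'.
have [v2 Ev2 v2P] := density n e e0.
have [M2 M21 v2M] := Cstar_ub (subalg_Cstar saE Ev2).
(* With k2 above M2^2, N2 is large enough for [cutmxP], and N2 / k2 = r^2 bounds v3 by r. Where v2
   is at most M + e, c2 is at most (M + e)^2 / r^2, so truncation changes v2 by at most e. *)
pose k2 := (Num.truncn (M2 ^+ 2)).+1.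
have k20 : (0 : R) < k2%:R by rewrite ltr0n.
pose N2 := k2%:R * r ^+ 2.
have N20 : 0 < N2 by rewrite mulr_gt0// exprn_gt0.
have v2N y : opnorm (v2 y) ^+ 2 <= N2.
  apply: le_trans (bound v2 _ y M21 (v2M y)) _.
  apply: (@le_trans _ _ k2%:R); first exact/ltW/truncnS_gt.
  by rewrite ler_peMr ?ler0n// exprn_ege1.
pose c2 : tfun T := fun x => cutmx N2 k2 (v2 x).
have Ec2 : E c2 by exact: subalg_cut.
have c2P y := cutmxP k2 N20 (v2N y).
pose v3 : tfun T := fun x => v2 x - v2 x *m c2 x.
have Ev3 : E v3 by exact: (subalg_subr saE Ev2 (subalg_mul saE Ev2 Ec2)).
have v3r y : opnorm (v3 y) <= r.
  have [_ _ _ /(_ isT) h] := c2P y.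
  have e3 : v3 y = v2 y *m (1%:M - c2 y) by rewrite mulmxBr mulmx1.
  have e4 : N2 / k2%:R = r ^+ 2 by rewrite /N2 mulrAC divff ?mul1r// gt_eqF.
  move: h; rewrite e4 e3 ler_pXn2r ?nnegrE ?opnorm_ge0// ltW//.
exists (fun x => v3 x *m c1 x); first exact: (subalg_mul saE Ev3 Ec1).
move=> y yX; have [yn|ny] := leqP (deg y) n.
  have uv2 := v2P y yX yn.
  have v2Me : opnorm (v2 y) <= M + e.
    have -> : v2 y = u y - (u y - v2 y) by rewrite opprB addrC subrK.
    exact: le_trans (opnormB _ _) (lerD (uM y) uv2).
  have v2c2 : opnorm (v2 y *m c2 y) <= e.
    have [_ _ h _] := c2P y; apply: le_trans re.
    have e4 : k2%:R / N2 = (r ^+ 2)^-1.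
      by rewrite /N2 invfM mulrA divff ?mul1r// gt_eqF.
    rewrite e4 in h; rewrite exprS -mulrA.
    apply: (opnormM_le v2Me); apply: (le_trans h); rewrite mulrC ler_wpM2r//.
      by rewrite invr_ge0 exprn_ge0// ltW.
    by apply: (bound _ _ _ _ v2Me); rewrite ler_wpDr// ltW.
  have [c11 c11' _ _] := c1P y.
  have uc1 : opnorm (u y *m (1%:M - c1 y)) <= e + e.
    have [yD|Dy] := leqP (deg y) D.
      have -> : u y *m (1%:M - c1 y) =
          (u y - v1 y) *m (1%:M - c1 y) + v1 y *m (1%:M - c1 y).
        by rewrite -mulmxDl subrK.
      apply: le_trans (opnormD _ _) (lerD _ (v1c1 y)).
      by have := opnormM_le (v1P y yX yD) c11'; rewrite mulr1.
    apply: (@le_trans _ _ e); last by rewrite lerDl ltW.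
    by have := opnormM_le (usmall y yX Dy) c11'; rewrite mulr1.
  (* The three terms are at most 2 e, e and e. *)
  have -> : u y - v3 y *m c1 y =
      u y *m (1%:M - c1 y) + ((u y - v2 y) *m c1 y + v2 y *m c2 y *m c1 y).
    have -> : (u y - v2 y) *m c1 y + v2 y *m c2 y *m c1 y = (u y - v3 y) *m c1 y.
      by rewrite -mulmxDl /v3 opprB addrA addrAC.
    by move: (v3 y) (c1 y) (u y) => a b c; rewrite mulmxBr mulmx1 mulmxBl addrA subrK.
  have -> : 4 * e = e + e + (e + e) by ring.
  apply: le_trans (opnormD _ _) (lerD uc1 _).
  apply: le_trans (opnormD _ _) (lerD _ _).
    by have := opnormM_le uv2 c11; rewrite mulr1.
  by have := opnormM_le v2c2 c11; rewrite mulr1.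
have uy : opnorm (u y) <= e by apply: usmall yX (leq_ltn_trans (leq_maxl _ _) ny).
have c1y : opnorm (c1 y) <= e / r.
  apply: c1L; split; first exact: yX.
  by move=> /LD'; rewrite leqNgt (leq_ltn_trans (leq_maxr _ _) ny).
have vc : opnorm (v3 y *m c1 y) <= e.
  by have := opnormM_le (v3r y) c1y; rewrite mulrC divfK ?gt_eqF.
apply: le_trans (opnormB _ _) _; apply: le_trans (lerD uy vc) _.
have -> : e + e = 2 * e by ring.
by rewrite ler_pM2r// ler_nat.
Qed.

End Density.

(** * Linear subspaces of matrices are closed *)

Section ClosedSubspace.
Variable R : realType.
Local Notation C := (Cplx R).
Local Notation r2c := (real_complex R : R -> C).

Lemma entry_le_opnorm n (A : 'M[C]_n) i j : complex.Re `|A i j| <= opnorm A.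
Proof.
have h := opnormP A (delta_mx j 0); rewrite vnorm_delta mulr1 -colE in h.
apply: le_trans h; rewrite -(@ler_pXn2r _ 2)// ?nnegrE ?vnorm_ge0//; last first.
  by rewrite -(@lecR R) Re_norm_r2c normr_ge0.
rewrite vnorm_sqr (bigD1 i)// mxE lerDl sumr_ge0// => k _; exact: sqr_ge0.
Qed.

(** A matrix [B] of maximal rank with row space inside S spans S. If A lay outside, a column of
    [cokermx B] would be a functional vanishing on S but not at A; being bounded by c times the
    operator norm, it would keep A away from S. *)
Lemma subspace_closed n (S : set 'M[C]_n) (A : 'M[C]_n) :
  S 0 -> (forall X Y, S X -> S Y -> S (X + Y)) ->
  (forall c X, S X -> S (c *: X)) ->
  (forall e, 0 < e -> exists2 X, S X & opnorm (A - X) < e) -> S A.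
Proof.
move=> S0 SD SZ Acl.
pose inS (B : 'M[C]_(n * n)) := forall v : 'rV_(n * n), (v <= B)%MS -> S (vec_mx v).
pose P r := `[< exists B, inS B /\ \rank B = r >].
have exP : exists r, P r.
  exists 0%N; apply/asboolP; exists 0; split; last exact: mxrank0.
  by move=> v; rewrite submx0 => /eqP ->; rewrite linear0.
have ubP r : P r -> (r <= n * n)%N by move=> /asboolP[B [_ <-]]; exact: rank_leq_row.
case: (ex_maxnP exP ubP) => r /asboolP[B [SB rB]] maxr.
have spanS X : S X -> (mxvec X <= B)%MS.
  move=> SX; apply: contraT => nXB.
  have SBX : inS (B + mxvec X)%MS.
    move=> v /sub_addsmxP[[a b] /= ->]; rewrite linearD; apply: SD.
      by apply: SB; exact: submxMl.
    by rewrite [b]mx11_scalar mul_scalar_mx linearZ /= mxvecK; exact: SZ.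
  have := maxr (\rank (B + mxvec X)%MS).
  have -> : P (\rank (B + mxvec X)%MS) by apply/asboolP; exists (B + mxvec X)%MS.
  move=> /(_ isT); rewrite -rB leqNgt => /negP; case; apply: rank_ltmx.
  by rewrite /ltmx addsmxSl addsmx_sub submx_refl (negbTE nXB).
have [AB|] := boolP (mxvec A <= B)%MS; first by rewrite -[A]mxvecK; exact: SB.
rewrite submxE => /matrix0Pn[i [j]]; rewrite ord1 => {i} d0.
pose d := (mxvec A *m cokermx B) 0 j.
pose c := 1 + \sum_k complex.Re `|cokermx B k j|.
have Re0 (z : C) : 0 <= complex.Re `|z| by rewrite -(@lecR R) Re_norm_r2c normr_ge0.
have c0 : 0 < c by rewrite ltr_pwDl// sumr_ge0.
have dpos : 0 < complex.Re `|d| by rewrite -(@ltcR R) Re_norm_r2c normr_gt0.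
have [X SX AX] := Acl _ (divr_gt0 dpos c0).
have dE : d = (mxvec (A - X) *m cokermx B) 0 j.
  rewrite linearB mulmxBl; have := spanS X SX; rewrite submxE => /eqP ->.
  by rewrite subr0.
suff : complex.Re `|d| <= opnorm (A - X) * c.
  by move: AX; rewrite ltr_pdivlMr// => h /(lt_le_trans h); rewrite ltxx.
rewrite -(@lecR R) Re_norm_r2c dE mxE; apply: le_trans (ler_norm_sum _ _ _) _.
apply: (@le_trans _ _ (r2c (\sum_k opnorm (A - X) * complex.Re `|cokermx B k j|))).
  rewrite (rmorph_sum (real_complex R)); apply: ler_sum => k _.
  rewrite normrM -[`|cokermx B k j|]Re_norm_r2c.
  rewrite [X in _ <= X](rmorphM (real_complex R)).
  apply: ler_wpM2r; first by rewrite -[0]/(r2c 0) lecR.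
  rewrite -[X in X <= _]Re_norm_r2c lecR.
  by case/mxvec_indexP: k => a b; rewrite mxvecE; exact: entry_le_opnorm.
by rewrite lecR -mulr_sumr ler_wpM2l ?opnorm_ge0// lerDr.
Qed.

End ClosedSubspace.

(** * From the separation hypothesis to the uniform closure *)

Section Main.
Variables (R : realType) (T : tower R) (E : set (tfun T)).
Hypothesis saE : star_subalgebra (Cstar0 T) E.
Hypothesis sepE : forall t : T, irreducible t ->
  (forall g, E g -> g t = 0) \/
  (forall s : T, irreducible s -> disjt s t ->
     exists2 g, E g & g t = 1%:M /\ g s = 0).
Implicit Types (s t x : T) (u v g : tfun T).

Lemma core_density u : Cstar0 T u ->
  (forall t, irreducible t -> exists2 v, E v & v t = u t) ->
  forall e, 0 < e -> exists2 v, E v &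
    forall t, irreducible t -> opnorm (u t - v t) <= e.
Proof.
move=> u0 uE e e0.
(* If all irreducible elements are equivalent, the second alternative of [sepE]
   is void and does not even provide a [g] with [g t = 1]. *)
have [[t [it only]]|many] :=
    pselect (exists t : T, irreducible t /\ forall s, irreducible s -> equivt t s).
  have [v Ev vt] := uE t it; exists v => // s /only ts.
  have uvC := Cstar_tsub u0.1 (subalg_Cstar saE Ev).
  have := opnorm_equivt uvC ts; rewrite /tsub vt subrr opnorm0 => <-.
  exact: ltW.
(* Separating elements for single s are multiplied to treat a list. *)
have isolE t : irreducible t -> (forall g, E g -> g t = 0) \/
    forall ss : seq T, (forall s, List.In s ss -> irreducible s /\ ~ equivt s t) ->
      exists2 g, E g & g t = 1%:M /\ forall s, List.In s ss -> g s = 0.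
  move=> it; case: (sepE it) => [|sep]; [by left|right].
  elim=> [_|s ss IH ssP].
    (* For the empty list, any irreducible s not equivalent to t is disjoint from t and provides g
       with g t = 1. *)
    have [s [is_ ts]] : exists s, irreducible s /\ ~ equivt t s.
      apply: contrapT => h; apply: many; exists t; split=> // s is_.
      by apply: contrapT => ts; apply: h; exists s.
    case: (irreducible_disjt is_ it) => [/equivt_sym//|st].
    by have [g Eg [gt _]] := sep s is_ st; exists g.
  have [is_ st] := ssP s (or_introl erefl).
  case: (irreducible_disjt is_ it) => // dst.
  have [g Eg [gt gs]] := sep s is_ dst.
  have [h Eh [ht hs]] : exists2 h, E h & h t = 1%:M /\ forall s, List.In s ss -> h s = 0.
    by apply: IH => s' ss'; apply: ssP; right.
  exists (fun x => g x *m h x); first exact: (subalg_mul saE Eg Eh).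
  split; first by rewrite gt ht; exact: mulmx1.
  by move=> s' [<-|/hs hs']; [rewrite gs; exact: mul0mx|rewrite hs'; exact: mulmx0].
have [v Ev vP] := uniform_density saE isolE u0 uE (divr_gt0 e0 (ltr0n R 4)).
exists v; first exact: Ev.
by move=> t it; have := vP t (core_clcore it); rewrite mulrC divfK.
Qed.

(** A tower may be empty; [supnorm] is then [sup set0], which is 0. *)
Lemma supnorm_le f c : 0 <= c -> (forall x, opnorm (f x) <= c) -> @supnorm R T f <= c.
Proof.
move=> c0 fc; have [[x _]|nT] := pselect (exists x : T, True).
  by apply: ge_sup => [|_ [y _ <-]//]; exists (opnorm (f x)), x.
rewrite /supnorm (_ : norms f = set0) ?sup0//.
by rewrite -subset0 => z [x _ _]; apply: nT; exists x.
Qed.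

End Main.

Unset Implicit Arguments.
Set Strict Implicit.
Set Printing Implicit Defensive.

Theorem theorem4p2 (R : realType) (T : tower R) (E : set (tfun T))
  (mtT : is_mtower T) (elcT : essentially_locally_compact T)
  (saE : star_subalgebra (Cstar0 T) E)
  (sepE : forall t : T, irreducible t ->
     (forall g : tfun T, E g -> g t = 0) \/
     (forall s : T, irreducible s -> disjt s t ->
        exists2 g : tfun T, E g & g t = 1%:M /\ g s = 0)) :
  uniform_closure (Cstar0 T) E =
  [set u : tfun T | Cstar0 T u /\
     forall x : T, core T x -> exists2 v : tfun T, E v & v x = u x].
Proof.
apply/seteqP; split=> u [u0 uP]; (split; first exact: u0).
  move=> x _; apply: (@subspace_closed _ _ [set A | exists2 v, E v & v x = A]) => /=.
  - by exists (tzero (T := T)); first exact: (subalg0 saE).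
  - move=> X Y [f Ef fX] [g Eg gY]; exists (tadd f g); first exact: (subalgD saE).
    by rewrite /tadd fX gY.
  - move=> c X [f Ef fX]; exists (tscale c f); first exact: (subalgZ saE).
    by rewrite /tscale fX.
  move=> e e0; have [v Ev uv] := uP e e0.
  exists (v x); first by exists v.
  apply: le_lt_trans uv; apply: ub_le_sup; last by exists x.
  exact: (Cstar_bounded (Cstar_tsub u0.1 (subalg_Cstar saE Ev))).
(* Half of e, because the supremum has to be strictly below e. *)
move=> e e0; have e2 : 0 < e / 2 by rewrite divr_gt0.
have [v Ev vP] := core_density saE sepE u0 uP e2.
exists v; first exact: Ev.
apply: (@le_lt_trans _ _ (e / 2)); last by rewrite ltr_pdivrMr// ltr_pMr// ltr1n.
apply: supnorm_le => [|x]; first exact: ltW.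
(* The bound passes from the irreducible components of x to x. *)
have [ts [ts1 _ ts3]] := decomposition x.
apply/(ts3 _ (Cstar_tsub u0.1 (subalg_Cstar saE Ev))) => t /ts1; exact: vP.
Qed.
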